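(* For every state $\rho$ on $\mathbb{C}^d$, the distillable coherence equals the relative entropy of coherence: $$C_d(\rho)=C_r(\rho)=\min_{\sigma\in\Delta}S(\rho\|\sigma).$$
   Context: Fix an orthonormal (incoherent) basis $\{\ket{i}\}$ of $\mathbb{C}^d$; on tensor products the incoherent basis is the product basis. Incoherent states $\Delta$ are density matrices diagonal in this basis; $\Delta(\rho)=\sum_i\bra{i}\rho\ket{i}\ket{i}\!\bra{i}$. An incoherent operation is a CPTP map $T(\rho)=\sum_\ell K_\ell\rho K_\ell^\dagger$ having a Kraus representation with each $K_\ell=\sum_i c_\ell(i)\ket{j_\ell(i)}\!\bra{i}$ for some function $j_\ell$ of basis indices (input and output spaces may differ, each with its incoherent basis). $\Phi_2=\ket{\Phi_2}\!\bra{\Phi_2}$ with $\ket{\Phi_2}=\frac{1}{\sqrt2}(\ket{0}+\ket{1})$. Fidelity: $F(\rho,\sigma)=\operatorname{tr}\sqrt{\rho^{1/2}\sigma\rho^{1/2}}$. The distillable coherence $C_d(\rho)$ is the supremum of rates $R\ge0$ such that there exist incoherent operations $T_n$ with $F\big(T_n(\rho^{\otimes n}),\Phi_2^{\otimes \lfloor nR\rfloor}\big)\ge1-\epsilon_n$ where $\epsilon_n\to0$ as $n\to\infty$. $S(\rho\|\sigma)=\operatorname{tr}\rho(\log\rho-\log\sigma)$ is the quantum relative entropy (logarithms base 2). *)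

(* Defs.v *)
(* R : realType, complex numbers R[i] (mathcomp-real-closed),
   extended reals and limits from MathComp-Analysis. *)
From Stdlib Require Import ClassicalEpsilon.
From HB Require Import structures.
From mathcomp Require Import all_boot all_order all_algebra.
From mathcomp Require Import complex mxtens.
From mathcomp Require Import all_classical all_reals ereal topology normedtype
  sequences exp.

Set Implicit Arguments.
Unset Strict Implicit.
Unset Printing Implicit Defensive.

Import Order.TTheory GRing.Theory Num.Theory numFieldNormedType.Exports.
Local Open Scope ring_scope.
Local Open Scope classical_set_scope.
Local Open Scope complex_scope.

Section Quantum.
Variable R : realType.
Local Notation C := (R[i]).

(* conjugate transpose *)
Definition adjmx m n (A : 'M[C]_(m, n)) : 'M[C]_(n, m) :=
  (map_mx (fun z : C => z^*) A)^T.

(* positive semidefinite: <v|A|v> >= 0 (in the order of C: real and >= 0) *)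
Definition psdmx n (A : 'M[C]_n) : Prop :=
  forall v : 'cV[C]_n, 0 <= (adjmx v *m A *m v) ord0 ord0.

(* density matrices (states) *)
Definition density n (rho : 'M[C]_n) : Prop := psdmx rho /\ \tr rho = 1.

(* incoherent states: states diagonal in the computational basis *)
Definition incoherent_state n (sigma : 'M[C]_n) : Prop :=
  density sigma /\ forall i j : 'I_n, i != j -> sigma i j = 0.

Definition unitarymx n (U : 'M[C]_n) : Prop :=
  adjmx U *m U = 1%:M /\ U *m adjmx U = 1%:M.

(* A = U diag(l) U^dagger with U unitary and l real *)
Definition spectral_decomp n (A : 'M[C]_n) (U : 'M[C]_n) (l : 'rV[R]_n) : Prop :=
  unitarymx U /\ A = U *m diag_mx (map_mx (fun x : R => x%:C) l) *m adjmx U.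

(* functional calculus f(A) for a Hermitian (normal with real spectrum) A,
   via a chosen spectral decomposition; the result does not depend on the choice *)
Definition mfun n (f : R -> R) (A : 'M[C]_n) : 'M[C]_n :=
  let p := epsilon (inhabits ((1%:M : 'M[C]_n), (0 : 'rV[R]_n)))
                   (fun p => spectral_decomp A p.1 p.2) in
  p.1 *m diag_mx (map_mx (fun x : R => (f x)%:C) p.2) *m adjmx p.1.

Definition msqrt n (A : 'M[C]_n) : 'M[C]_n := mfun (@Num.sqrt R) A.

(* log base 2 on positive reals, 0 elsewhere (only used on the support) *)
Definition log2 (x : R) : R := if 0 < x then ln x / ln 2 else 0.
Definition mlog2 n (A : 'M[C]_n) : 'M[C]_n := mfun log2 A.

(* fidelity F(rho, sigma) = tr sqrt(rho^{1/2} sigma rho^{1/2}) *)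
Definition fidelity n (rho sigma : 'M[C]_n) : R :=
  complex.Re (\tr (msqrt (msqrt rho *m sigma *m msqrt rho))).

(* quantum relative entropy (base 2), +oo unless supp rho <= supp sigma *)
Definition relent n (rho sigma : 'M[C]_n) : \bar R :=
  if `[< forall v : 'cV[C]_n, sigma *m v = 0 -> rho *m v = 0 >]
  then (complex.Re (\tr (rho *m (mlog2 rho - mlog2 sigma))))%:E
  else +oo%E.

(* relative entropy of coherence C_r(rho) = inf_{sigma incoherent} S(rho||sigma) *)
Definition rel_ent_coh n (rho : 'M[C]_n) : \bar R :=
  ereal_inf [set relent rho sigma | sigma in [set s | incoherent_state s]].

(* incoherent Kraus operator: K = sum_i c(i) |j(i)><i| *)
Definition incoherent_kraus m n (K : 'M[C]_(n, m)) : Prop :=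
  forall i : 'I_m, exists j : 'I_n, forall j' : 'I_n, j' != j -> K j' i = 0.

(* incoherent operation: CPTP map with a (finite) Kraus representation by
   incoherent Kraus operators *)
Definition incoherent_op m n (T : 'M[C]_m -> 'M[C]_n) : Prop :=
  exists (L : nat) (K : 'I_L -> 'M[C]_(n, m)),
    [/\ forall l, incoherent_kraus (K l),
        \sum_(l < L) adjmx (K l) *m K l = 1%:M
      & forall rho, T rho = \sum_(l < L) K l *m rho *m adjmx (K l)].

(* dimension d^k of the k-fold tensor power *)
Fixpoint dpow (d k : nat) : nat :=
  match k with 0 => 1 | k'.+1 => d * dpow d k' end.

(* k-fold tensor (Kronecker) power, product basis *)
Fixpoint tpow d (A : 'M[C]_d) (k : nat) : 'M[C]_(dpow d k) :=
  match k return 'M[C]_(dpow d k) with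
  | 0 => 1%:M
  | k'.+1 => A *t tpow A k'
  end.

(* Phi_2 = |Phi_2><Phi_2|, |Phi_2> = (|0> + |1>)/sqrt 2 *)
Definition Phi2 : 'M[C]_2 := const_mx (1 / 2).

(* r is an achievable rate of coherence distillation from rho *)
Definition achievable_rate d (rho : 'M[C]_d) (r : R) : Prop :=
  0 <= r /\
  exists T : forall n : nat, 'M[C]_(dpow d n) -> 'M[C]_(dpow 2 (Num.truncn (n%:R * r))),
    (forall n, incoherent_op (T n)) /\
    exists eps : nat -> R, eps @ \oo --> (0 : R) /\
      forall n, 1 - eps n <= fidelity (T n (tpow rho n)) (tpow Phi2 (Num.truncn (n%:R * r))).

(* distillable coherence: supremum of achievable rates *)
Definition distillable_coherence d (rho : 'M[C]_d) : \bar R :=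
  ereal_sup [set r%:E | r in achievable_rate rho].

End Quantum.

(* Main.v *)
Require Import Defs.
From Stdlib Require Import ClassicalEpsilon.
From HB Require Import structures.
From mathcomp Require Import all_boot all_order all_algebra.
From mathcomp Require Import complex mxtens.
From mathcomp Require Import all_classical all_reals ereal topology normedtype
  sequences exp.
From mathcomp Require Import ring lra.
Local Open Scope ring_scope.
Local Open Scope classical_set_scope.

(** Write rho = U diag(l) U^+ and let p be the diagonal of rho.  Gibbs' inequality
    gives C_r(rho) = H(p) - H(l), attained at sigma = diag(p).

    Converse.  If T is incoherent, the effect A = T^+(Phi_M) satisfies 0 <= A <= 1
    and has all its diagonal entries equal to 1/M, because each column of a Kraus
    operator has at most one nonzero entry.  Sandwiching rho^n between the
    projection on its typical eigenvectors and the (diagonal) projection on the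
    typical sequences of p^n then shows that <Phi_M|T(rho^n)|Phi_M> is at most
    2^(n(H(p) - H(l) + o(1))) / M up to the atypical masses; no data-processing
    inequality is needed.

    Achievability.  Bin the typical sequences by a random function f into M blocks,
    let Q_k be the projection on block k, P the projection on the typical
    eigenvalues, A_k = Q_k U P and X_k = M A_k^+ A_k, whose mean over f is close to
    P.  The matrices V_k = 2 (1 + X_k)^-1 A_k^+ are, up to a factor M^(-1/2),
    contractions supported on block k, so that sqrt M V_k, with block k mapped to
    |k>, defines incoherent Kraus operators; what is missing to trace preservation
    is sent to a fixed basis vector.  The overlap with Phi_M is controlled by
    2 (1 + X_k)^-1 X_k >= (3 X_k - X_k^2) / 2 and by the second moment of X_k,
    which needs only M <= 2^(n(H(p) - H(l) - o(1))). *)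

Section Coherence.
Set Implicit Arguments.
Unset Strict Implicit.
Import Order.TTheory GRing.Theory Num.Theory numFieldNormedType.Exports.
Local Open Scope complex_scope.

(** * Matrices over the complex numbers *)

Section LinearAlgebra.
Variable R : realType.
Local Notation C := (R[i]).
Implicit Types m n p : nat.

Lemma adjmxE m n (A : 'M[C]_(m, n)) i j : adjmx A i j = (A j i)^*.
Proof. by rewrite !mxE. Qed.

Lemma adjmxK m n (A : 'M[C]_(m, n)) : adjmx (adjmx A) = A.
Proof. by apply/matrixP => i j; rewrite !mxE conjcK. Qed.

Lemma adjmx_mul m n p (A : 'M[C]_(m, n)) (B : 'M[C]_(n, p)) :
  adjmx (A *m B) = adjmx B *m adjmx A.
Proof. by rewrite /adjmx map_mxM trmx_mul. Qed.

Lemma adjmxD m n (A B : 'M[C]_(m, n)) : adjmx (A + B) = adjmx A + adjmx B.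
Proof. by rewrite /adjmx map_mxD linearD. Qed.

Lemma adjmxB m n (A B : 'M[C]_(m, n)) : adjmx (A - B) = adjmx A - adjmx B.
Proof. by rewrite /adjmx map_mxB linearB. Qed.

Lemma adjmxZ m n (x : R) (A : 'M[C]_(m, n)) :
  adjmx (x%:C *: A) = x%:C *: adjmx A.
Proof. by apply/matrixP => i j; rewrite !mxE rmorphM /= oppr0. Qed.

Lemma adjmx_scale m n (c : C) (A : 'M[C]_(m, n)) :
  adjmx (c *: A) = c^* *: adjmx A.
Proof. by apply/matrixP => i j; rewrite !mxE rmorphM. Qed.

Lemma adjmx1 n : adjmx (1%:M : 'M[C]_n) = 1%:M.
Proof. by rewrite /adjmx map_mx1 trmx1. Qed.

(** Valued in [R] rather than in [R[i]], so that all estimates take place in an ordered real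
    field. *)
Definition normsq (z : C) : R := complex.Re z ^+ 2 + complex.Im z ^+ 2.

Lemma normsqE z : (normsq z)%:C = z^* * z.
Proof. by case: z => a b; rewrite /normsq; simpc; congr (_ +i* _) => /=; ring. Qed.

Lemma normsq_ge0 z : 0 <= normsq z.
Proof. by rewrite addr_ge0 ?sqr_ge0. Qed.

Lemma normsq0 : normsq 0 = 0.
Proof. by rewrite /normsq /= !expr0n addr0. Qed.

Lemma normsq_eq0 z : normsq z = 0 -> z = 0.
Proof.
move=> /eqP; rewrite /normsq paddr_eq0 ?sqr_ge0// !sqrf_eq0.
by case: z => a b /= /andP[/eqP -> /eqP ->].
Qed.

Lemma normsqM z w : normsq (z * w) = normsq z * normsq w.
Proof. by case: z w => a b [c e]; rewrite /normsq /=; ring. Qed.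

Lemma normsq_conj z : normsq z^* = normsq z.
Proof. by case: z => a b; rewrite /normsq /= sqrrN. Qed.

Lemma normsq_real (x : R) : normsq x%:C = x ^+ 2.
Proof. by rewrite /normsq /= expr0n addr0. Qed.

Lemma ReD (z w : C) : complex.Re (z + w) = complex.Re z + complex.Re w.
Proof. by case: z w => a b [c e]. Qed.

Lemma ReB (z w : C) : complex.Re (z - w) = complex.Re z - complex.Re w.
Proof. by case: z w => a b [c e]. Qed.

Lemma ImD (z w : C) : complex.Im (z + w) = complex.Im z + complex.Im w.
Proof. by case: z w => a b [c e]. Qed.

Lemma Re_conj (z : C) : complex.Re z^* = complex.Re z.
Proof. by case: z. Qed.

Lemma ReZ (x : R) (z : C) : complex.Re (x%:C * z) = x * complex.Re z.
Proof. by case: z => a b /=; rewrite mul0r subr0. Qed.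

Lemma Re_sum I (r : seq I) (P : pred I) (F : I -> C) :
  complex.Re (\sum_(i <- r | P i) F i) = \sum_(i <- r | P i) complex.Re (F i).
Proof. by elim/big_rec2: _ => // i x y _ <-; rewrite ReD. Qed.

Lemma Im_sum I (r : seq I) (P : pred I) (F : I -> C) :
  complex.Im (\sum_(i <- r | P i) F i) = \sum_(i <- r | P i) complex.Im (F i).
Proof. by elim/big_rec2: _ => // i x y _ <-; rewrite ImD. Qed.

Lemma real_complex_sum I (r : seq I) (P : pred I) (F : I -> R) :
  (\sum_(i <- r | P i) F i)%:C = \sum_(i <- r | P i) (F i)%:C.
Proof. exact: rmorph_sum. Qed.

Lemma real_complexB (x y : R) : (x - y)%:C = x%:C - y%:C.
Proof. exact: rmorphB. Qed.

Lemma real_complexM (x y : R) : (x * y)%:C = x%:C * y%:C.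
Proof. exact: rmorphM. Qed.

Lemma normsqD_le z w : normsq (z + w) <= 2 * normsq z + 2 * normsq w.
Proof.
case: z w => a b [c e]; rewrite /normsq /=.
have := sqr_ge0 (a - c); have := sqr_ge0 (b - e); nra.
Qed.

(** Cauchy-Schwarz against the constant vector: with s the sum and q the sum of squares, the sum of
    (n a_i - s)^2 expands to n (n q - s^2). *)
Lemma sqr_sum_le n (a : 'I_n -> R) :
  (\sum_i a i) ^+ 2 <= n%:R * \sum_i a i ^+ 2.
Proof.
case: n a => [|n] a; first by rewrite !big_ord0 expr0n mul0r.
set s := \sum_i _; set q := \sum_i _.
have : 0 <= \sum_i (n.+1%:R * a i - s) ^+ 2 by apply: sumr_ge0 => i _; exact: sqr_ge0.
have -> : \sum_i (n.+1%:R * a i - s) ^+ 2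
    = n.+1%:R ^+ 2 * q - 2 * n.+1%:R * s * s + n.+1%:R * s ^+ 2.
  rewrite (eq_bigr (fun i => n.+1%:R ^+ 2 * a i ^+ 2 +
     (- 2 * n.+1%:R * s * a i + s ^+ 2))); last by move=> i _; ring.
  rewrite !big_split -!mulr_sumr /= -/s -/q sumr_const card_ord -mulr_natl.
  ring.
have n0 : 0 < n.+1%:R :> R by rewrite ltr0n.
have -> : n.+1%:R ^+ 2 * q - 2 * n.+1%:R * s * s + n.+1%:R * s ^+ 2 =
  n.+1%:R * (n.+1%:R * q - s ^+ 2) by ring.
by rewrite pmulr_rge0// subr_ge0.
Qed.

Lemma normsq_sum_le n (y : 'I_n -> C) :
  normsq (\sum_i y i) <= n%:R * \sum_i normsq (y i).
Proof.
rewrite /normsq Re_sum Im_sum big_split mulrDr.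
by apply: lerD; exact: sqr_sum_le.
Qed.

(** * Hilbert-Schmidt inner product and norm *)

Definition hsdot m n (A B : 'M[C]_(m, n)) : R := complex.Re (\tr (adjmx A *m B)).
(** This is the square of the Hilbert-Schmidt norm. In [hsdot] only the real part of the inner
    product is kept, which makes it symmetric. *)
Definition hsnorm m n (A : 'M[C]_(m, n)) : R := \sum_i \sum_j normsq (A i j).

Lemma hsnorm_tr m n (A : 'M[C]_(m, n)) : (hsnorm A)%:C = \tr (adjmx A *m A).
Proof.
rewrite /hsnorm exchange_big real_complex_sum; apply: eq_bigr => j _.
rewrite real_complex_sum mxE; apply: eq_bigr => i _.
by rewrite normsqE adjmxE.
Qed.

Lemma hsnorm_dot m n (A : 'M[C]_(m, n)) : hsnorm A = hsdot A A.
Proof. by rewrite /hsdot -hsnorm_tr. Qed.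

Lemma hsnorm_ge0 m n (A : 'M[C]_(m, n)) : 0 <= hsnorm A.
Proof. by apply: sumr_ge0 => i _; apply: sumr_ge0 => j _; exact: normsq_ge0. Qed.

Lemma hsnorm_eq0 m n (A : 'M[C]_(m, n)) : hsnorm A = 0 -> A = 0.
Proof.
move=> h; apply/matrixP => i j; rewrite mxE; apply: normsq_eq0.
move: h => /eqP; rewrite psumr_eq0; last first.
  by move=> k _; apply: sumr_ge0 => l _; exact: normsq_ge0.
move=> /allP/(_ i); rewrite mem_index_enum => /(_ isT) /=.
rewrite psumr_eq0; last by move=> l _; exact: normsq_ge0.
by move=> /allP/(_ j); rewrite mem_index_enum => /(_ isT) /= /eqP.
Qed.

Lemma hsnorm_adj m n (A : 'M[C]_(m, n)) : hsnorm (adjmx A) = hsnorm A.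
Proof.
rewrite /hsnorm exchange_big; apply: eq_bigr => i _; apply: eq_bigr => j _.
by rewrite adjmxE normsq_conj.
Qed.

Lemma hsnormZ m n (x : R) (A : 'M[C]_(m, n)) : hsnorm (x%:C *: A) = x ^+ 2 * hsnorm A.
Proof.
rewrite /hsnorm mulr_sumr; apply: eq_bigr => i _; rewrite mulr_sumr.
by apply: eq_bigr => j _; rewrite mxE normsqM normsq_real.
Qed.

Lemma hsnormD_le m n (A B : 'M[C]_(m, n)) : hsnorm (A + B) <= 2 * hsnorm A + 2 * hsnorm B.
Proof.
rewrite /hsnorm !mulr_sumr -big_split; apply: ler_sum => i _.
rewrite !mulr_sumr -big_split; apply: ler_sum => j _.
by rewrite mxE normsqD_le.
Qed.

Lemma hsdotC m n (A B : 'M[C]_(m, n)) : hsdot A B = hsdot B A.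
Proof.
rewrite /hsdot -[adjmx A *m B]adjmxK adjmx_mul adjmxK /adjmx mxtrace_tr.
have -> (D : 'M[C]_n) : \tr (map_mx conjc D) = (\tr D)^*.
  by rewrite /mxtrace rmorph_sum; apply: eq_bigr => i _; rewrite mxE.
by rewrite Re_conj.
Qed.

Lemma hsdotBr m n (A B D : 'M[C]_(m, n)) : hsdot A (B - D) = hsdot A B - hsdot A D.
Proof. by rewrite /hsdot mulmxBr raddfB /= ReB. Qed.

Lemma hsnormB m n (A B : 'M[C]_(m, n)) :
  hsnorm (A - B) = hsnorm A + hsnorm B - 2 * hsdot A B.
Proof.
by rewrite !hsnorm_dot hsdotBr hsdotC hsdotBr (hsdotC (A - B)) hsdotBr (hsdotC B A); ring.
Qed.

(** Young's inequality: the squared norm of x A - B is nonnegative. *)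
Lemma hsdot_le m n (x : R) (A B : 'M[C]_(m, n)) :
  2 * x * hsdot A B <= x ^+ 2 * hsnorm A + hsnorm B.
Proof.
have := hsnorm_ge0 (x%:C *: A - B).
rewrite hsnormB hsnormZ /hsdot adjmxZ -scalemxAl mxtraceZ ReZ -/(hsdot A B); lra.
Qed.

Lemma hsdotZl m n (x : R) (A B : 'M[C]_(m, n)) : hsdot (x%:C *: A) B = x * hsdot A B.
Proof. by rewrite /hsdot adjmxZ -scalemxAl mxtraceZ ReZ. Qed.

Lemma hsdot_mull m n p (A : 'M[C]_(m, n)) (B : 'M[C]_(p, n)) (K : 'M[C]_(m, p)) :
  hsdot A (K *m B) = hsdot (adjmx K *m A) B.
Proof. by rewrite /hsdot adjmx_mul adjmxK mulmxA. Qed.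

Lemma hsdot_mulr m n p (A : 'M[C]_(m, n)) (B : 'M[C]_(m, p)) (K : 'M[C]_(p, n)) :
  hsdot A (B *m K) = hsdot (A *m adjmx K) B.
Proof. by rewrite /hsdot adjmx_mul adjmxK mulmxA mxtrace_mulC mulmxA. Qed.

Lemma hsnorm_isometry m n p (U : 'M[C]_(m, n)) (A : 'M[C]_(n, p)) :
  adjmx U *m U = 1%:M -> hsnorm (U *m A) = hsnorm A.
Proof. by move=> hU; rewrite !hsnorm_dot hsdot_mull mulmxA hU mul1mx. Qed.

Lemma hsnorm_coisometry m n p (U : 'M[C]_(n, m)) (A : 'M[C]_(p, n)) :
  U *m adjmx U = 1%:M -> hsnorm (A *m U) = hsnorm A.
Proof. by move=> hU; rewrite !hsnorm_dot hsdot_mulr -mulmxA hU mulmx1. Qed.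

Lemma tr_sum n I (r : seq I) (P : pred I) (F : I -> 'M[C]_n) :
  \tr (\sum_(i <- r | P i) F i) = \sum_(i <- r | P i) \tr (F i).
Proof. by elim/big_rec2: _ => [|i x y _ <-]; rewrite ?mxtrace0 ?mxtraceD. Qed.

(** Trace preservation says that the operators [K l], stacked on top of each other, form an
    isometry. *)
Lemma hsnorm_kraus L m n p (K : 'I_L -> 'M[C]_(n, m)) (A : 'M[C]_(m, p)) :
  \sum_l adjmx (K l) *m K l = 1%:M -> \sum_l hsnorm (K l *m A) = hsnorm A.
Proof.
move=> hK; transitivity (hsdot (\sum_l (adjmx (K l) *m K l *m A)) A); last first.
  by rewrite -mulmx_suml hK mul1mx hsnorm_dot.
rewrite hsdotC /hsdot mulmx_sumr tr_sum Re_sum; apply: eq_bigr => l _.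
by rewrite hsnorm_dot hsdot_mull hsdotC mulmxA.
Qed.

Lemma psd_gram m n (A : 'M[C]_(m, n)) : psdmx (adjmx A *m A).
Proof.
move=> v; rewrite mulmxA -mulmxA -adjmx_mul.
suff -> : (adjmx (A *m v) *m (A *m v)) ord0 ord0 = (hsnorm (A *m v))%:C.
  by rewrite ler0c hsnorm_ge0.
by rewrite hsnorm_tr /mxtrace big_ord1.
Qed.

Lemma psd_congr m n (A : 'M[C]_m) (B : 'M[C]_(m, n)) :
  psdmx A -> psdmx (adjmx B *m A *m B).
Proof. by move=> hA v; have := hA (B *m v); rewrite adjmx_mul !mulmxA. Qed.

Lemma psd_sum n I (r : seq I) (P : pred I) (F : I -> 'M[C]_n) :
  (forall i, psdmx (F i)) -> psdmx (\sum_(i <- r | P i) F i).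
Proof.
move=> hF v; elim/big_rec: _ => [|i x _ hx]; first by rewrite mulmx0 mul0mx mxE.
by rewrite mulmxDr mulmxDl mxE addr_ge0 ?hF.
Qed.

(** * Real diagonal matrices *)

Definition dg n (f : 'I_n -> R) : 'M[C]_n := diag_mx (\row_i (f i)%:C).

Lemma mul_dg m n (f : 'I_m -> R) (A : 'M[C]_(m, n)) i j :
  (dg f *m A) i j = (f i)%:C * A i j.
Proof. by rewrite mul_diag_mx !mxE. Qed.

Lemma mulmx_dg m n (f : 'I_n -> R) (A : 'M[C]_(m, n)) i j :
  (A *m dg f) i j = A i j * (f j)%:C.
Proof. by rewrite mul_mx_diag !mxE. Qed.

Lemma dgE n (f : 'I_n -> R) i j : dg f i j = (f i)%:C *+ (i == j).
Proof. by rewrite !mxE. Qed.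

Lemma eq_dg n (f g : 'I_n -> R) : f =1 g -> dg f = dg g.
Proof. by move=> h; apply/matrixP => i j; rewrite !dgE h. Qed.

Lemma dgM n (f g : 'I_n -> R) : dg f *m dg g = dg (fun i => f i * g i).
Proof.
by apply/matrixP => i j; rewrite mul_dg !dgE mulrnAr rmorphM.
Qed.

Lemma dg1 n : dg (fun _ : 'I_n => 1) = 1%:M.
Proof. by apply/matrixP => i j; rewrite dgE mxE. Qed.

Lemma adj_dg n (f : 'I_n -> R) : adjmx (dg f) = dg f.
Proof.
apply/matrixP => i j; rewrite adjmxE !dgE rmorphMn /= oppr0 eq_sym.
by case: eqP => [->|].
Qed.

End LinearAlgebra.

(** * Spectral decomposition and fidelity *)

Section FunctionalCalculus.
Variable R : realType.
Local Notation C := (R[i]).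
Implicit Types m n : nat.

Lemma quad_delta n (A : 'M[C]_n) i j :
  (adjmx (delta_mx i ord0 : 'cV[C]_n) *m A *m (delta_mx j ord0 : 'cV[C]_n))
    ord0 ord0 = A i j.
Proof.
have -> : adjmx (delta_mx i ord0 : 'cV[C]_n) = delta_mx ord0 i.
  by apply/matrixP => k l; rewrite adjmxE !mxE andbC; case: (_ && _); rewrite ?conjc1 ?conjc0.
by rewrite -rowE -colE !mxE.
Qed.

Lemma psd_diag_ge0 n (A : 'M[C]_n) i : psdmx A -> 0 <= A i i.
Proof. by move=> /(_ (delta_mx i ord0)); rewrite quad_delta. Qed.

(** A quadratic form that is real on all complex vectors is Hermitian. Polarise on e_j + c e_i: the
    vanishing imaginary parts for c = 1 and c = i compare A_ij with the conjugate of A_ji. *)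
Lemma psd_hermitian n (A : 'M[C]_n) : psdmx A -> adjmx A = A.
Proof.
move=> hA; apply/matrixP => i j; rewrite adjmxE.
pose e k : 'cV[C]_n := delta_mx k ord0.
have h (c : C) : 0 <= A j j + c * A j i + c^* * A i j + c^* * c * A i i.
  have := hA (e j + c *: e i); rewrite adjmxD adjmx_scale !mulmxDl !mulmxDr.
  have ME (X Y : 'M[C]_1) : (X + Y) ord0 ord0 = X ord0 ord0 + Y ord0 ord0 by rewrite mxE.
  have ZE a (X : 'M[C]_1) : (a *: X) ord0 ord0 = a * X ord0 ord0 by rewrite mxE.
  rewrite -!(scalemxAl, scalemxAr) !(ME, ZE) !quad_delta.
  by congr (0 <= _); ring.
have := ger0_Im (h 1); have := ger0_Im (h 'i%C).
have := ger0_Im (psd_diag_ge0 i hA); have := ger0_Im (psd_diag_ge0 j hA).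
case: (A j j) (A i i) (A i j) (A j i) => a b [a' b'] [x y] [x' y'] /=.
move=> -> -> h1 h2; congr (_ +i* _); move: h1 h2; simpc => /=; lra.
Qed.

Lemma psd_spectral n (A : 'M[C]_n) : psdmx A ->
  exists U l, spectral_decomp A U l.
Proof.
move=> hA.
have Ah : A \is hermsymmx.
  apply/is_hermitianmxP; rewrite expr0 scale1r -{1}(psd_hermitian hA).
  by rewrite /adjmx map_trmx.
have /hermitian_normalmx/orthomx_spectralP := Ah.
have := hermitian_spectral_diag_real Ah; have := spectral_unitarymx A.
move: (spectralmx A) (spectral_diag A) => P sp Pu spr eA.
have PE : invmx P = adjmx P.
  by rewrite invmx_unitary // /adjmx map_trmx.
have Pun : P \in unitmx by exact: unitarymx_unit.
exists (adjmx P), (\row_i complex.Re (sp ord0 i)); split.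
  by split; rewrite adjmxK -PE ?mulmxV ?mulVmx.
rewrite adjmxK -PE {1}eA; congr (_ *m diag_mx _ *m _).
by apply/rowP => i; rewrite !mxE RRe_real// (mxOverP spr).
Qed.

Lemma spectral_decompE n (A U : 'M[C]_n) l :
  spectral_decomp A U l -> A = U *m dg (fun e => l ord0 e) *m adjmx U.
Proof.
move=> [_ {1}->]; congr (_ *m diag_mx _ *m _).
by apply/rowP => i; rewrite !mxE.
Qed.

Lemma spectral_conj n (A U : 'M[C]_n) l : spectral_decomp A U l ->
  adjmx U *m A *m U = dg (fun e => l ord0 e).
Proof.
move=> h; rewrite (spectral_decompE h); case: h => [[h1 h2] _].
by rewrite !mulmxA h1 mul1mx -mulmxA h1 mulmx1.
Qed.

Lemma spectral_ge0 n (A U : 'M[C]_n) l i : psdmx A -> spectral_decomp A U l ->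
  0 <= l ord0 i.
Proof.
move=> hA /spectral_conj h; have := psd_diag_ge0 i (psd_congr U hA).
by rewrite h dgE eqxx mulr1n ler0c.
Qed.

(** The decomposition inside [mfun] is chosen independently of f, so a single pair [U], [l] serves
    every f at once. *)
Lemma mfunP n (A : 'M[C]_n) : psdmx A -> exists U l,
  [/\ spectral_decomp A U l, forall e, 0 <= l ord0 e &
   forall f, mfun f A = U *m dg (fun e => f (l ord0 e)) *m adjmx U].
Proof.
move=> hA; set p := epsilon (inhabits ((1%:M : 'M[C]_n), (0 : 'rV[R]_n)))
                   (fun q => spectral_decomp A q.1 q.2).
have hp : spectral_decomp A p.1 p.2.
  apply: (epsilon_spec (inhabits ((1%:M : 'M[C]_n), (0 : 'rV[R]_n)))
    (fun q => spectral_decomp A q.1 q.2)).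
  by have [U [l h]] := psd_spectral hA; exists (U, l).
exists p.1, p.2; split => // [e|f]; first exact: spectral_ge0 hp.
rewrite /mfun -/p; congr (_ *m diag_mx _ *m _).
by apply/rowP => i; rewrite !mxE.
Qed.

Lemma dg_psd n (f : 'I_n -> R) : (forall i, 0 <= f i) -> psdmx (dg f).
Proof.
move=> hf; have -> : dg f = adjmx (dg (fun i => Num.sqrt (f i))) *m
    dg (fun i => Num.sqrt (f i)).
  by rewrite adj_dg dgM; apply: eq_dg => i; rewrite -expr2 sqr_sqrtr.
exact: psd_gram.
Qed.

(** The chosen decomposition of a diagonal matrix need not be the trivial one. Its unitary
    intertwines [dg s] with the chosen spectrum, so s_i = l_j wherever U_ij is nonzero, and f can be
    applied on both sides of that equation. *)
Lemma mfun_dg n (f : R -> R) (s : 'I_n -> R) : (forall i, 0 <= s i) ->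
  mfun f (dg s) = dg (fun i => f (s i)).
Proof.
move=> s0; have [U [l [hU _ ->]]] := mfunP (dg_psd s0).
have [[h1 h2] _] := hU.
have : dg s *m U = U *m dg (fun e => l ord0 e).
  by rewrite {1}(spectral_decompE hU) -mulmxA h1 mulmx1.
move=> /matrixP e.
have -> : U *m dg (fun e => f (l ord0 e)) = dg (fun i => f (s i)) *m U.
  apply/matrixP => i j; have := e i j; rewrite !mulmx_dg !mul_dg.
  rewrite [U i j * _ in X in X -> _]mulrC.
  have [->|u0] := eqVneq (U i j) 0; first by rewrite !mulr0 mul0r.
  by move=> /(mulIf u0) /complexI ->; rewrite mulrC.
by rewrite -mulmxA h2 mulmx1.
Qed.

Lemma psd_factor n (A : 'M[C]_n) : psdmx A ->
  exists B : 'M[C]_n, A = adjmx B *m B.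
Proof.
move=> hA; have [U [l [hU l0 _]]] := mfunP hA.
exists (dg (fun e => Num.sqrt (l ord0 e)) *m adjmx U).
rewrite adjmx_mul adjmxK adj_dg !mulmxA -[X in X *m _]mulmxA dgM.
rewrite (spectral_decompE hU); congr (_ *m _ *m _); apply: eq_dg => i.
by rewrite -expr2 sqr_sqrtr.
Qed.

Lemma msqrtP n (A : 'M[C]_n) : psdmx A ->
  adjmx (msqrt A) = msqrt A /\ msqrt A *m msqrt A = A.
Proof.
move=> hA; have [U [l [hU l0 hf]]] := mfunP hA; rewrite /msqrt hf.
have [[h1 h2] _] := hU; split.
  by rewrite !adjmx_mul adjmxK adj_dg mulmxA.
rewrite !mulmxA -[X in X *m _ *m _]mulmxA h1 mulmx1 -[X in X *m _]mulmxA dgM.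
rewrite (spectral_decompE hU); congr (_ *m _ *m _); apply: eq_dg => i.
by rewrite -expr2 sqr_sqrtr.
Qed.

(** B^2 = s B forces every eigenvalue to be 0 or s, hence sqrt(l_i) sqrt(s) = l_i; summing and using
    the trace gives sqrt(s), with s = 0 treated apart. *)
Lemma tr_msqrt_rank1 n (B : 'M[C]_n) (s : R) : psdmx B -> 0 <= s ->
  B *m B = s%:C *: B -> \tr B = s%:C -> \tr (msqrt B) = (Num.sqrt s)%:C.
Proof.
move=> hB s0 hBB htr; have [U [l [hU l0 hf]]] := mfunP hB; rewrite /msqrt hf.
have [[h1 h2] _] := hU.
have tr_conj (D : 'M[C]_n) : \tr (U *m D *m adjmx U) = \tr D.
  by rewrite mxtrace_mulC mulmxA h1 mul1mx.
have hl i : l ord0 i * l ord0 i = s * l ord0 i.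
  have : dg (fun e => l ord0 e) *m dg (fun e => l ord0 e) =
      s%:C *: dg (fun e => l ord0 e).
    rewrite -(spectral_conj hU) -!mulmxA (mulmxA U) h2 mul1mx (mulmxA B) hBB.
    by rewrite -scalemxAl -scalemxAr.
  move=> /matrixP/(_ i i); rewrite dgM [in RHS]mxE !dgE eqxx !mulr1n -rmorphM.
  exact: complexI.
have htl : \sum_i l ord0 i = s.
  apply: (@complexI R); rewrite -htr (spectral_decompE hU) tr_conj rmorph_sum.
  by apply: eq_bigr => i _; rewrite dgE eqxx.
rewrite tr_conj /mxtrace -[in RHS]htl.
have sq i : Num.sqrt (l ord0 i) * Num.sqrt s = l ord0 i.
  have /eqP := hl i; rewrite -subr_eq0 -mulrBl mulf_eq0 subr_eq0.
  by move=> /orP[] /eqP ->; rewrite ?sqrtr0 ?mul0r// -expr2 sqr_sqrtr.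
have [s00|sn0] := eqVneq s 0.
  have lz i : l ord0 i = 0 by rewrite -(sq i) s00 sqrtr0 mulr0.
  rewrite htl s00 sqrtr0; apply: big1 => i _.
  by rewrite dgE eqxx lz sqrtr0.
have s1 : Num.sqrt s != 0 by rewrite sqrtr_eq0 -ltNge lt_neqAle eq_sym sn0.
transitivity (((\sum_i l ord0 i) / Num.sqrt s)%:C); last first.
  by rewrite htl -{1}(sqr_sqrtr s0) expr2 mulfK.
rewrite mulr_suml rmorph_sum; apply: eq_bigr => i _.
by rewrite dgE eqxx -{2}(sq i) mulfK.
Qed.

(* <Phi_M| X |Phi_M> for the maximally coherent state of dimension M *)
Definition overlap M (X : 'M[C]_M) : R :=
  complex.Re (\sum_i \sum_j X i j) / M%:R.

Lemma overlap_gram M n (B : 'M[C]_(M, n)) :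
  overlap (B *m adjmx B) = hsnorm ((const_mx 1 : 'rV_M) *m B) / M%:R.
Proof.
rewrite /overlap; congr (_ / _); rewrite /hsnorm big_ord1.
transitivity (complex.Re (\sum_j (normsq (((const_mx 1 : 'rV_M) *m B) ord0 j))%:C)).
  congr (complex.Re _).
  transitivity (\sum_i \sum_j \sum_k B i k * (B j k)^*).
    apply: eq_bigr => i _; apply: eq_bigr => j _; rewrite mxE.
    by apply: eq_bigr => k _; rewrite adjmxE.
  under eq_bigr do rewrite exchange_big.
  rewrite exchange_big; apply: eq_bigr => k _; rewrite normsqE mxE.
  under [in RHS]eq_bigr do rewrite mxE mul1r.
  rewrite mulrC mulr_suml; apply: eq_bigr => i _.
  by rewrite rmorph_sum mulr_sumr.
by rewrite -real_complex_sum.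
Qed.

(** The constant matrix has rank one, so the sandwiched matrix is w w^+ / M with w = sqrt(X) 1; its
    only possibly nonzero eigenvalue is the overlap. *)
Lemma fidelity_max_coherent M (X : 'M[C]_M) : (0 < M)%N -> psdmx X ->
  fidelity X (const_mx (M%:R^-1)) = Num.sqrt (overlap X).
Proof.
move=> M0 hX; have [hs ss] := msqrtP hX; rewrite /fidelity.
set S := msqrt X in hs ss *.
pose w : 'cV[C]_M := S *m const_mx 1.
have M1 : M%:R != 0 :> C by rewrite pnatr_eq0 -lt0n.
have c1 : (const_mx (M%:R^-1) : 'M[C]_M) =
   ((M%:R^-1 : R)%:C) *: ((const_mx 1 : 'cV[C]_M) *m adjmx (const_mx 1 : 'cV[C]_M)).
  apply/matrixP => i j; rewrite !mxE big_ord1 !mxE conjc1 !mulr1.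
  by rewrite (fmorphV (real_complex R)) rmorph_nat.
have ov : hsnorm w = overlap X * M%:R.
  have := overlap_gram S; rewrite hs ss => ->.
  rewrite mulfVK ?pnatr_eq0 -?lt0n // -hsnorm_adj adjmx_mul hs.
  congr (hsnorm (_ *m _)); apply/matrixP => i j; rewrite !mxE.
  by rewrite conjc1.
have -> : S *m const_mx (M%:R^-1) *m S = (M%:R^-1 : R)%:C *: (w *m adjmx w).
  by rewrite c1 /w adjmx_mul hs -scalemxAr -scalemxAl !mulmxA.
have wE : adjmx w *m w = ((hsnorm w)%:C)%:M.
  by rewrite [LHS]mx11_scalar hsnorm_tr /mxtrace big_ord1.
have MR : M%:R != 0 :> R by rewrite pnatr_eq0 -lt0n.
have ovE : overlap X = M%:R^-1 * hsnorm w by rewrite ov mulrC mulfK.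
rewrite (@tr_msqrt_rank1 _ _ (overlap X)) //.
- have -> : (M%:R^-1 : R)%:C *: (w *m adjmx w) =
     adjmx ((Num.sqrt (M%:R^-1 : R))%:C *: adjmx w) *m
     ((Num.sqrt (M%:R^-1 : R))%:C *: adjmx w).
    rewrite adjmxZ adjmxK -scalemxAl -scalemxAr scalerA -rmorphM -expr2.
    by rewrite sqr_sqrtr// invr_ge0.
  exact: psd_gram.
- by rewrite ovE mulr_ge0 ?hsnorm_ge0// invr_ge0.
- rewrite -scalemxAl -scalemxAr mulmxA -(mulmxA w) wE mul_mx_scalar -scalemxAl.
  rewrite !scalerA ovE !rmorphM /=. by congr (_ *: _); ring.
- by rewrite mxtraceZ mxtrace_mulC wE /mxtrace big_ord1 mxE eqxx mulr1n ovE rmorphM.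
Qed.

End FunctionalCalculus.

(** * The relative entropy of coherence *)

Section RelativeEntropy.
Variable R : realType.
Local Notation C := (R[i]).
Implicit Types m n : nat.

Definition entropy n (f : 'I_n -> R) : R := - \sum_i f i * log2 (f i).

Lemma ln2_gt0 : 0 < ln 2 :> R.
Proof. by rewrite ln_gt0// ltr1n. Qed.

(** The tangent bound 1 + t <= exp t at t = ln s - ln p, multiplied by p. For p = 0 the right side
    is 0 and the left side is -s / ln 2. *)
Lemma gibbs_term (p s : R) : 0 <= p -> 0 <= s -> (s = 0 -> p = 0) ->
  (p - s) / ln 2 <= p * (log2 p - log2 s).
Proof.
move=> p0 s0 sp; rewrite /log2.
have [pp|pn] := ltP 0 p; last first.
  have -> : p = 0 by apply/eqP; rewrite eq_le pn p0.
  by rewrite mul0r sub0r mulNr oppr_le0 divr_ge0// ltW// ln2_gt0.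
have ss : 0 < s.
  by rewrite lt_neqAle s0 andbT eq_sym; apply/eqP => /sp pe; rewrite pe ltxx in pp.
rewrite ss -mulrBl mulrA ler_pM2r ?invr_gt0 ?ln2_gt0//.
have := expR_ge1Dx (ln s - ln p); rewrite expRD expRN !lnK ?posrE//.
rewrite -(ler_pM2l pp) mulrCA mulfV ?gt_eqF//; lra.
Qed.

Lemma gibbs n (p s : 'I_n -> R) : (forall i, 0 <= p i) -> (forall i, 0 <= s i) ->
  \sum_i p i = 1 -> \sum_i s i = 1 -> (forall i, s i = 0 -> p i = 0) ->
  \sum_i p i * log2 (s i) <= - entropy p.
Proof.
move=> p0 s0 p1 s1 sp; rewrite /entropy opprK -subr_ge0 -sumrB.
apply: (@le_trans _ _ (\sum_i (p i - s i) / ln 2)).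
  by rewrite -mulr_suml sumrB p1 s1 subrr mul0r.
by apply: ler_sum => i _; rewrite -mulrBr; apply: gibbs_term => //; exact: sp.
Qed.

Lemma spectral_diag_entry n (A U : 'M[C]_n) l i : spectral_decomp A U l ->
  A i i = (\sum_e l ord0 e * normsq (U i e))%:C.
Proof.
move=> /spectral_decompE ->; rewrite mxE real_complex_sum.
apply: eq_bigr => e _; rewrite mulmx_dg adjmxE [in RHS]rmorphM [X in _ = _ * X]normsqE; ring.
Qed.

Lemma spectral_trace n (A U : 'M[C]_n) l : spectral_decomp A U l ->
  \tr A = (\sum_e l ord0 e)%:C.
Proof.
move=> h; rewrite (spectral_decompE h) mxtrace_mulC mulmxA h.1.1 mul1mx.
by rewrite real_complex_sum; apply: eq_bigr => e _; rewrite dgE eqxx.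
Qed.

(** The logarithm of a diagonal matrix is diagonal, so the cross term sees only the diagonal of
    [rho]. *)
Lemma relent_dg n (rho U : 'M[C]_n) l (s : 'I_n -> R) :
  psdmx rho -> (forall i, 0 <= s i) ->
  spectral_decomp rho U l ->
  (forall f, mfun f rho = U *m dg (fun e => f (l ord0 e)) *m adjmx U) ->
  complex.Re (\tr (rho *m (mlog2 rho - mlog2 (dg s)))) =
  - entropy (fun e => l ord0 e) -
    \sum_i complex.Re (rho i i) * log2 (s i).
Proof.
move=> hr s0 hU hf; rewrite mulmxBr raddfB /= ReB /entropy opprK; congr (_ - _).
  rewrite /mlog2 hf {1}(spectral_decompE hU) !mulmxA -[X in \tr (X *m _ *m _)]mulmxA.
  rewrite hU.1.1 mulmx1 -[X in \tr (X *m _)]mulmxA dgM mxtrace_mulC mulmxA.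
  rewrite hU.1.1 mul1mx /mxtrace Re_sum; apply: eq_bigr => e _.
  by rewrite dgE eqxx.
rewrite /mlog2 mfun_dg// /mxtrace Re_sum; apply: eq_bigr => i _.
by rewrite mulmx_dg mulrC ReZ mulrC.
Qed.

Lemma rel_ent_cohE n (rho U : 'M[C]_n) l : density rho ->
  spectral_decomp rho U l ->
  (forall f, mfun f rho = U *m dg (fun e => f (l ord0 e)) *m adjmx U) ->
  let C_r := entropy (fun i => complex.Re (rho i i)) -
    entropy (fun e => l ord0 e) in
  rel_ent_coh rho = C_r%:E /\
  exists sigma, incoherent_state sigma /\ relent rho sigma = C_r%:E.
Proof.
move=> [hr htr] hU hf C_r.
pose p i := complex.Re (rho i i).
have pE i : rho i i = (p i)%:C by rewrite /p (spectral_diag_entry i hU).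
have p0 i : 0 <= p i by have := psd_diag_ge0 i hr; rewrite pE ler0c.
have p1 : \sum_i p i = 1.
  by apply: (@complexI R); rewrite real_complex_sum;
    transitivity (\tr rho) => //; apply: eq_bigr => i _.
have l0 e := spectral_ge0 e hr hU.
have incoh : incoherent_state (dg p).
  split; first split.
  - exact: dg_psd.
  - rewrite -htr; apply: eq_bigr => i _; by rewrite dgE eqxx pE.
  - by move=> i j ij; rewrite dgE (negbTE ij).
have val : relent rho (dg p) = C_r%:E.
  rewrite /relent asboolT.
    rewrite (relent_dg hr p0 hU hf); congr (_%:E).
    by rewrite /C_r {2}/entropy -/p; lra.
  move=> v hv; have pv i : (p i)%:C * v i ord0 = 0.
    by have /matrixP/(_ i ord0) := hv; rewrite mul_dg mxE.
  (* A zero diagonal entry of a positive matrix kills its whole column: each summand l_e |U_ie|^2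
     must vanish. This gives the support inclusion for [dg p]. *)
  have zc i k : p i = 0 -> rho k i = 0.
    rewrite (spectral_decompE hU) => pi0; rewrite mxE; apply: big1 => e _.
    rewrite mulmx_dg adjmxE.
    have : \sum_e l ord0 e * normsq (U i e) = 0.
      by apply: (@complexI R); rewrite -(spectral_diag_entry i hU) pE pi0.
    move=> /eqP; rewrite psumr_eq0 => [|e' _]; last by rewrite mulr_ge0 ?normsq_ge0.
    move=> /allP/(_ e); rewrite mem_index_enum => /(_ isT) /=.
    rewrite mulf_eq0 => /orP[/eqP ->|/eqP/normsq_eq0 ->].
      by rewrite mulr0 mul0r.
    by rewrite conjc0 mulr0.
  apply/matrixP => k j; rewrite (ord1 j) !mxE; apply: big1 => i _.
  have /eqP := pv i; rewrite mulf_eq0 => /orP[/eqP pi0|/eqP ->]; last by rewrite mulr0.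
  by rewrite zc ?mul0r//; apply: (@complexI R).
split; last by exists (dg p).
apply/eqP; rewrite eq_le; apply/andP; split.
  by apply: ereal_inf_lbound; exists (dg p).
apply: le_ereal_inf_tmp => _ [sigma [[hs hst] hd] <-].
pose s i := complex.Re (sigma i i).
have sE i : sigma i i = (s i)%:C.
  by rewrite /s RRe_real// ger0_real// psd_diag_ge0.
have s0 i : 0 <= s i by have := psd_diag_ge0 i hs; rewrite sE ler0c.
have s1 : \sum_i s i = 1.
  by apply: (@complexI R); rewrite real_complex_sum;
    transitivity (\tr sigma) => //; apply: eq_bigr => i _.
have se : sigma = dg s.
  apply/matrixP => i j; rewrite dgE; case: eqP => [<-|/eqP ij]; first by rewrite sE.
  exact: hd.
rewrite /relent; case: asboolP => [supp|_]; last by rewrite leey.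
rewrite se (relent_dg hr s0 hU hf) lee_fin /C_r.
suff : \sum_i p i * log2 (s i) <= - entropy p by rewrite /p; lra.
(* A zero of [s] puts a basis vector in the kernel of [sigma], hence by [supp] in that of [rho], so
   the same entry of [p] vanishes. *)
apply: gibbs => // i si0; apply: (@complexI R).
have : sigma *m delta_mx i ord0 = 0 :> 'cV_n.
  apply/matrixP => k j; rewrite -colE !mxE se dgE.
  by case: eqP => [->|//]; rewrite si0.
by move=> /supp; rewrite -colE => /matrixP/(_ i ord0); rewrite !mxE pE => ->.
Qed.

End RelativeEntropy.

(** * One-shot converse *)

Section OneShot.
Variable R : realType.
Local Notation C := (R[i]).
Implicit Types m n : nat.

Definition ones M : 'rV[C]_M := const_mx 1.

(** The i-th diagonal entry of U diag(l) U^+, that is, the outcome distribution of measuring in the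
    incoherent basis. *)
Definition weight n (U : 'M[C]_n) (l : 'I_n -> R) (i : 'I_n) : R :=
  \sum_e l e * normsq (U i e).

Lemma hsnorm_ones M n (Y : 'M[C]_(M, n)) : hsnorm (ones M *m Y) <= M%:R * hsnorm Y.
Proof.
rewrite /hsnorm big_ord1 exchange_big mulr_sumr; apply: ler_sum => j _.
rewrite mxE; apply: le_trans (normsq_sum_le _) _.
by rewrite le_eqVlt; apply/orP; left; apply/eqP; congr (_ * _);
  apply: eq_bigr => k _; rewrite mxE mul1r.
Qed.

Lemma unitary_row n (U : 'M[C]_n) i : U *m adjmx U = 1%:M ->
  \sum_e normsq (U i e) = 1.
Proof.
move=> /matrixP/(_ i i); rewrite !mxE eqxx mulr1n => h.
apply: (@complexI R); rewrite real_complex_sum -[RHS]h.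
by apply: eq_bigr => e _; rewrite normsqE adjmxE mulrC.
Qed.

Lemma unitary_col n (U : 'M[C]_n) e : adjmx U *m U = 1%:M ->
  \sum_i normsq (U i e) = 1.
Proof.
move=> h; rewrite -[RHS](@unitary_row _ (adjmx U) e) ?adjmxK//.
by apply: eq_bigr => i _; rewrite adjmxE normsq_conj.
Qed.

Lemma hsnorm_dgl m n (q : 'I_m -> R) (A : 'M[C]_(m, n)) :
  hsnorm (dg q *m A) = \sum_i q i ^+ 2 * \sum_j normsq (A i j).
Proof.
rewrite /hsnorm; apply: eq_bigr => i _; rewrite mulr_sumr.
by apply: eq_bigr => j _; rewrite mul_dg normsqM normsq_real.
Qed.

Lemma hsnorm_dgr m n (q : 'I_n -> R) (A : 'M[C]_(m, n)) :
  hsnorm (A *m dg q) = \sum_j q j ^+ 2 * \sum_i normsq (A i j).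
Proof.
rewrite /hsnorm exchange_big; apply: eq_bigr => i _; rewrite mulr_sumr.
by apply: eq_bigr => j _; rewrite mulmx_dg normsqM normsq_real mulrC.
Qed.

(** Writing the state as B B^+ turns every overlap into a Hilbert-Schmidt norm, which is what both
    one-shot bounds estimate. *)
Lemma spectral_sqrt n (U : 'M[C]_n) (l : 'I_n -> R) : (forall e, 0 <= l e) ->
  U *m dg l *m adjmx U =
  (U *m dg (fun e => Num.sqrt (l e))) *m adjmx (U *m dg (fun e => Num.sqrt (l e))).
Proof.
move=> l0; rewrite adjmx_mul adj_dg !mulmxA -[in RHS](mulmxA U) dgM.
by congr (_ *m _ *m _); apply: eq_dg => e; rewrite -expr2 sqr_sqrtr.
Qed.

Lemma overlapD M (X Y : 'M[C]_M) : overlap (X + Y) = overlap X + overlap Y.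
Proof.
rewrite /overlap -mulrDl -ReD; congr (complex.Re _ / _).
by rewrite -big_split; apply: eq_bigr => i _; rewrite -big_split;
  apply: eq_bigr => j _; rewrite mxE.
Qed.

Lemma overlap_sum M I (r : seq I) (F : I -> 'M[C]_M) :
  overlap (\sum_(i <- r) F i) = \sum_(i <- r) overlap (F i).
Proof.
elim/big_rec2: _ => [|i x y _ <-]; last by rewrite overlapD.
rewrite /overlap big1 ?mul0r// => i _; rewrite big1// => j _; by rewrite mxE.
Qed.

Lemma overlap_kraus M L n (K : 'I_L -> 'M[C]_(M, n)) m (B : 'M[C]_(n, m)) :
  overlap (\sum_l K l *m (B *m adjmx B) *m adjmx (K l)) =
  \sum_l hsnorm (ones M *m K l *m B) / M%:R.
Proof.
rewrite overlap_sum; apply: eq_bigr => l _.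
by rewrite mulmxA -mulmxA -adjmx_mul overlap_gram mulmxA.
Qed.

(** With at most one nonzero entry in the column, the squared modulus of the sum is the sum of the
    squared moduli. This is where the converse uses incoherence. *)
Lemma incoherent_kraus_col m n (K : 'M[C]_(n, m)) i : incoherent_kraus K ->
  normsq ((ones n *m K) ord0 i) = \sum_j normsq (K j i).
Proof.
move=> /(_ i) [j hj]; rewrite mxE (bigD1 j)//= big1 => [|j' jj']; last first.
  by rewrite hj// mulr0.
rewrite (bigD1 j)//= [in RHS]big1 => [|j' jj']; last by rewrite hj// normsq0.
by rewrite !addr0 mxE mul1r.
Qed.

(** Split B into B1 = Q B P and the rest. The rest costs the atypical masses, B1 costs mu times the
    size of [G], and the factors 2 come from the squared triangle inequality [hsnormD_le]. *)
Lemma converse_oneshot N M (U : 'M[C]_N) (l : 'I_N -> R) (T : 'M[C]_N -> 'M[C]_M)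
    (E G : pred 'I_N) (mu : R) :
  (0 < M)%N -> Defs.unitarymx U -> (forall e, 0 <= l e) -> incoherent_op T ->
  0 <= mu -> (forall e, E e -> l e <= mu) ->
  overlap (T (U *m dg l *m adjmx U)) <=
    2 * (\sum_(i | ~~ G i) weight U l i + \sum_(e | ~~ E e) l e) +
    2 * (mu * #|G|%:R / M%:R).
Proof.
move=> M0 [U1 U2] l0 [L [K [hinc hK ->]]] mu0 hE.
rewrite spectral_sqrt// overlap_kraus; set B := U *m _.
pose Q := dg (fun i : 'I_N => (G i)%:R : R).
pose P := dg (fun i : 'I_N => (E i)%:R : R).
pose B1 := Q *m B *m P.
have MR : 0 < M%:R :> R by rewrite ltr0n.
have tail : \sum_k hsnorm (ones M *m K k *m (B - B1)) <=
    M%:R * (\sum_(i | ~~ G i) weight U l i + \sum_(e | ~~ E e) l e).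
  apply: (@le_trans _ _ (\sum_k M%:R * hsnorm (K k *m (B - B1)))).
    by apply: ler_sum => k _; rewrite -mulmxA hsnorm_ones.
  rewrite -mulr_sumr hsnorm_kraus// ler_pM2l//.
  have -> : \sum_(i | ~~ G i) weight U l i + \sum_(e | ~~ E e) l e =
    \sum_i \sum_e (normsq (U i e) * l e) * ((~~ G i)%:R + (~~ E e)%:R).
    transitivity (\sum_i (\sum_e (~~ G i)%:R * (normsq (U i e) * l e) +
        \sum_e (~~ E e)%:R * (normsq (U i e) * l e))); last first.
      apply: eq_bigr => i _; rewrite -big_split; apply: eq_bigr => e _ /=; ring.
    rewrite big_split /=; congr (_ + _).
      rewrite big_mkcond; apply: eq_bigr => i _; rewrite -mulr_sumr.
      case: (G i); rewrite /= ?mul0r// mul1r.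
      by apply: eq_bigr => e _; rewrite mulrC.
    rewrite exchange_big big_mkcond; apply: eq_bigr => e _; rewrite -mulr_sumr.
    case: (E e); rewrite /= ?mul0r// mul1r -mulr_suml unitary_col//.
    by rewrite mul1r.
  apply: ler_sum => i _; apply: ler_sum => e _.
  (* With 0/1 indicators x of [G] and y of [E], (1 - x y)^2 <= (1 - x) + (1 - y). *)
  have -> : (B - B1) i e = (1 - (G i)%:R * (E e)%:R)%:C * (U i e * (Num.sqrt (l e))%:C).
    have BE (X Y : 'M[C]_N) : (X - Y) i e = X i e - Y i e by rewrite !mxE.
    by rewrite BE /B1 /Q /P [X in _ - X]mulmx_dg mul_dg /B mulmx_dg rmorphB rmorphM /=; ring.
  rewrite normsqM normsqM !normsq_real sqr_sqrtr// mulrC.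
  apply: ler_wpM2l; first by rewrite mulr_ge0 ?normsq_ge0.
  by case: (G i); case: (E e) => /=; rewrite ?mulr0 ?mulr1 ?subr0 ?subrr; lra.
have main : \sum_k hsnorm (ones M *m K k *m B1) <= mu * #|G|%:R.
  (* By [incoherent_kraus_col] the norms on the right add up to the diagonal entries of the sum of
     K^+ K over [G], and these are all 1. *)
  have -> : mu * #|G|%:R = \sum_k mu * hsnorm (ones M *m K k *m Q).
    rewrite -mulr_sumr; congr (_ * _).
    under eq_bigr do rewrite hsnorm_dgr.
    rewrite exchange_big -sum1_card natr_sum big_mkcond; apply: eq_bigr => i _ /=.
    rewrite -mulr_sumr (_ : (i \in G) = G i) //; case: (G i); rewrite /= ?expr0n ?mul0r//.
    rewrite expr1n mul1r; under eq_bigr do rewrite big_ord1 incoherent_kraus_col//.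
    have /matrixP/(_ i i) := hK; rewrite summxE mxE eqxx mulr1n => h.
    apply: (@complexI R); rewrite real_complex_sum -[LHS]h.
    apply: eq_bigr => k _; rewrite mxE real_complex_sum.
    by apply: eq_bigr => j _; rewrite normsqE adjmxE.
  apply: ler_sum => k _.
  (* The rightmost diagonal factor has squares at most [mu]; once it is bounded, the unitary [U]
     drops out of the norm. *)
  have -> : ones M *m K k *m B1 = (ones M *m K k *m Q *m U) *m
      dg (fun e => Num.sqrt (l e) * (E e)%:R).
    by rewrite -dgM /B1 /B !mulmxA.
  set X := ones M *m K k *m Q; rewrite -(hsnorm_coisometry X U2) hsnorm_dgr.
  rewrite [hsnorm (X *m U)]exchange_big mulr_sumr.
  apply: ler_sum => e _; apply: ler_wpM2r.
    by apply: sumr_ge0 => i _; exact: normsq_ge0.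
  rewrite exprMn sqr_sqrtr//; case: (boolP (E e)) => [/hE|_] /=.
    by rewrite expr1n mulr1.
  by rewrite expr0n mulr0.
rewrite -mulr_suml ler_pdivrMr//.
apply: (@le_trans _ _ (\sum_k (2 * hsnorm (ones M *m K k *m B1) +
   2 * hsnorm (ones M *m K k *m (B - B1))))).
  apply: ler_sum => k _; apply: le_trans (hsnormD_le _ _).
  by rewrite -mulmxDr subrKC.
rewrite big_split -!mulr_sumr /= [X in _ <= X]mulrDl.
have -> : 2 * (mu * #|G|%:R / M%:R) * M%:R = 2 * (mu * #|G|%:R).
  by rewrite -!mulrA mulVf ?gt_eqF// mulr1.
rewrite addrC; apply: lerD; last by rewrite ler_pM2l.
by rewrite -mulrA ler_pM2l// mulrC.
Qed.

End OneShot.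

(** * Kraus completion and the resolvent *)

Section Achievability.
Variable R : realType.
Local Notation C := (R[i]).
Implicit Types m n : nat.

(** The defect D = 1 - sum K^+ K is positive, so D = L^+ L. Sending each row of L to the fixed basis
    vector [j0] gives incoherent operators with total D, and their contribution to the overlap is
    nonnegative. *)
Lemma kraus_completion N M (j0 : 'I_M) (K : 'I_N -> 'M[C]_(M, N)) :
  (forall k, incoherent_kraus (K k)) ->
  (forall v : 'cV[C]_N, \sum_k hsnorm (K k *m v) <= hsnorm v) ->
  exists2 T : 'M[C]_N -> 'M[C]_M, incoherent_op T &
    forall B : 'M[C]_N,
      (\sum_k hsnorm (ones R M *m K k *m B)) / M%:R <= overlap (T (B *m adjmx B)).
Proof.
move=> hinc hK; pose D := 1%:M - \sum_k adjmx (K k) *m K k.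
have [L DL] : exists L : 'M[C]_N, D = adjmx L *m L.
  apply: psd_factor => v.
  suff -> : (adjmx v *m D *m v) ord0 ord0 = (hsnorm v - \sum_k hsnorm (K k *m v))%:C.
    by rewrite ler0c subr_ge0.
  rewrite real_complexB real_complex_sum hsnorm_tr /mxtrace big_ord1.
  rewrite mulmxBr mulmx1 mulmxBl mulmx_sumr mulmx_suml.
  have BE (X Y : 'M[C]_1) : (X - Y) ord0 ord0 = X ord0 ord0 - Y ord0 ord0.
    by rewrite !mxE.
  rewrite BE summxE; congr (_ - _); apply: eq_bigr => k _.
  by rewrite hsnorm_tr /mxtrace big_ord1 adjmx_mul !mulmxA.
pose K' (r : 'I_N) : 'M[C]_(M, N) := delta_mx j0 ord0 *m row r L.
pose KK (k : 'I_(N + N)) := match fintype.split k with inl x => K x | inr y => K' y end.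
have KKl k : KK (lshift N k) = K k by rewrite /KK (unsplitK (inl k)).
have KKr k : KK (rshift N k) = K' k by rewrite /KK (unsplitK (inr k)).
exists (fun rho => \sum_k KK k *m rho *m adjmx (KK k)).
  exists (N + N)%N, KK; split => //.
  - move=> k; rewrite /KK; case: fintype.split => // r i.
    exists j0 => j jj; rewrite mxE big_ord1 !mxE (negbTE jj) andFb mul0r //.
  - rewrite big_split_ord /=.
    under eq_bigr do rewrite KKl. under [X in _ + X]eq_bigr do rewrite KKr.
    have -> : \sum_r adjmx (K' r) *m K' r = D; last by rewrite subrKC.
    rewrite DL; apply/matrixP => a b; rewrite summxE mxE; apply: eq_bigr => r _.
    rewrite mxE (bigD1 j0)//= big1 => [|j jj]; last first.
      by rewrite [X in _ * X]mxE big_ord1 !mxE (negbTE jj) andFb mul0r mulr0.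
    by rewrite addr0 !adjmxE !mxE !big_ord1 !mxE eqxx !mul1r.
move=> B; rewrite overlap_kraus big_split_ord /=.
rewrite mulr_suml -[X in X <= _]addr0; apply: lerD.
  by under [X in _ <= X]eq_bigr do rewrite KKl.
by apply: sumr_ge0 => k _; rewrite divr_ge0 ?hsnorm_ge0.
Qed.

Lemma hsnorm_dg_le m n (q : 'I_m -> R) (A : 'M[C]_(m, n)) :
  (forall i, q i ^+ 2 <= 1) -> hsnorm (dg q *m A) <= hsnorm A.
Proof.
move=> hq; rewrite hsnorm_dgl; apply: ler_sum => i _; rewrite ler_piMl//.
by apply: sumr_ge0 => j _; exact: normsq_ge0.
Qed.

(** Expectation of [A] in the unnormalised diagonal state w, later the truncated state written in
    its eigenbasis. *)
Definition trdg n (w : 'I_n -> R) (A : 'M[C]_n) : R := complex.Re (\tr (dg w *m A)).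

Lemma trdgE n (w : 'I_n -> R) A : trdg w A = \sum_e w e * complex.Re (A e e).
Proof.
by rewrite /trdg /mxtrace Re_sum; apply: eq_bigr => e _; rewrite mul_dg ReZ.
Qed.

Lemma trdgD n (w : 'I_n -> R) A B : trdg w (A + B) = trdg w A + trdg w B.
Proof.
rewrite !trdgE -big_split; apply: eq_bigr => e _.
by rewrite mxE ReD mulrDr.
Qed.

Lemma trdgZ n (w : 'I_n -> R) x A : trdg w (x%:C *: A) = x * trdg w A.
Proof.
rewrite !trdgE mulr_sumr; apply: eq_bigr => e _.
by rewrite mxE ReZ mulrCA.
Qed.

Lemma trdg_sum n (w : 'I_n -> R) I (r : seq I) (F : I -> 'M[C]_n) :
  trdg w (\sum_(i <- r) F i) = \sum_(i <- r) trdg w (F i).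
Proof. by rewrite /trdg mulmx_sumr tr_sum Re_sum. Qed.

Lemma trdg_gram m n (w : 'I_n -> R) (A : 'M[C]_(m, n)) :
  trdg w (adjmx A *m A) = \sum_e w e * \sum_k normsq (A k e).
Proof.
rewrite trdgE; apply: eq_bigr => e _; congr (_ * _).
rewrite mxE Re_sum; apply: eq_bigr => k _.
by rewrite adjmxE -normsqE.
Qed.

Lemma trdg_gram_ge0 m n (w : 'I_n -> R) (A : 'M[C]_(m, n)) :
  (forall e, 0 <= w e) -> 0 <= trdg w (adjmx A *m A).
Proof.
move=> w0; rewrite trdg_gram; apply: sumr_ge0 => e _; rewrite mulr_ge0//.
by apply: sumr_ge0 => k _; exact: normsq_ge0.
Qed.

(** The matrix form of 4 X (X - 1)^2 / (1 + X) = 4 X^2 - 12 X + 16 X / (1 + X), where 2 - F = 2 X /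
    (1 + X). Positivity of the left side is what [resolventP] exploits. *)
Lemma resolvent_sandwich n (X F : 'M[C]_n) :
  (1%:M + X) *m F = 2%:M -> F *m (1%:M + X) = 2%:M ->
  (X - 1%:M) *m F *m ((1%:M + X) *m X) *m (F *m (X - 1%:M)) =
  (4 : R)%:C *: (X *m X) + (- 12 : R)%:C *: X + (8 : R)%:C *: (2%:M - F).
Proof.
set S := 1%:M + X => SF FS.
have FX : F *m X = 2%:M - F by rewrite -FS mulmxDr mulmx1 addrC addKr.
have XF : X *m F = 2%:M - F by rewrite -SF mulmxDl mul1mx addrC addKr.
have -> : F *m (X - 1%:M) = 2%:M - F - F by rewrite mulmxBr mulmx1 FX.
rewrite (mulmxA _ S) -(mulmxA _ F S) FS mul_mx_scalar -!scalemxAl -mulmxA.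
have -> : X *m (2%:M - F - F) = X + X - (2%:M - F) - (2%:M - F).
  rewrite !mulmxBr XF mul_mx_scalar; congr (_ - _ - _).
  by rewrite scaler_nat mulr2n.
rewrite mulmxBl mul1mx !mulmxBr mulmxDr XF mul_mx_scalar.
have r k : (k%:R : R)%:C = k%:R :> C by exact: rmorph_nat.
have rN : (- 12 : R)%:C = - 12%:R :> C by rewrite (rmorphN (real_complex R)) /= r.
rewrite rN !r; move: (X *m X) => XX.
apply/matrixP => i j; rewrite !mxE; ring.
Qed.

(* With X = x A^+ A, the matrix F = 2 (1 + X)^-1 makes F A^+ a contraction up to
   the factor x^(-1/2) (from 4X <= (1 + X)^2), while
   F X = 2 - F >= (3 X - X^2) / 2 is only second order away from X = 1. *)
Lemma resolventP n (x : R) (A : 'M[C]_n) : 0 <= x ->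
  exists F : 'M[C]_n,
  [/\ F *m (x%:C *: (adjmx A *m A)) = 2%:M - F,
      forall v : 'cV[C]_n, x * hsnorm (F *m adjmx A *m v) <= hsnorm v &
      forall w : 'I_n -> R, (forall e, 0 <= w e) ->
        let X := x%:C *: (adjmx A *m A) in
        3 * trdg w X - trdg w (X *m X) <= 2 * trdg w (2%:M - F)].
Proof.
move=> x0; pose X := x%:C *: (adjmx A *m A).
have Xh : adjmx X = X by rewrite adjmxZ adjmx_mul adjmxK.
pose S := 1%:M + X.
have Sh : adjmx S = S by rewrite adjmxD adjmx1 Xh.
have hquad (v : 'cV[C]_n) : hsdot v (S *m v) = hsnorm v + x * hsnorm (A *m v).
  rewrite mulmxDl mul1mx /hsdot mulmxDr mxtraceD ReD -!/(hsdot _ _) -hsnorm_dot; congr (_ + _).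
  by rewrite -scalemxAl hsdotC hsdotZl -mulmxA hsdotC hsdot_mull adjmxK hsnorm_dot.
(* By [hquad], S v = 0 forces the norm of v to vanish. *)
have Su : S \in unitmx.
  rewrite -unitmx_tr -row_free_unit -kermx_eq0; apply/eqP/row_matrixP => i.
  rewrite row0; set u := row i _.
  have hu : S *m u^T = 0.
    apply: trmx_inj; rewrite trmx_mul trmxK trmx0; apply/eqP.
    by rewrite -sub_kermx row_sub.
  apply: trmx_inj; rewrite trmx0; apply: hsnorm_eq0; apply/eqP; rewrite eq_le hsnorm_ge0 andbT.
  have := hquad u^T; rewrite hu /hsdot mulmx0 mxtrace0 /= => ->.
  by rewrite lerDl mulr_ge0 ?hsnorm_ge0.
pose F := (2 : R)%:C *: invmx S.
have two : ((2 : R)%:C *: 1%:M : 'M[C]_n) = 2%:M.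
  by rewrite scalemx1 (rmorph_nat (real_complex R) 2).
have SF : S *m F = 2%:M by rewrite -scalemxAr mulmxV// two.
have FS : F *m S = 2%:M by rewrite -scalemxAl mulVmx// two.
have FX : F *m X = 2%:M - F by rewrite -FS mulmxDr mulmx1 addrC addKr.
have XF : X *m F = 2%:M - F by rewrite -SF mulmxDl mul1mx addrC addKr.
exists F; split => //.
- move=> v; set y := F *m _ *m v.
  (* Thus |y|^2 + x |A y|^2 = 2 Re <A y, v>; multiplying by x and applying Young's inequality leaves
     x |y|^2 <= |v|^2. *)
  have : hsdot y (S *m y) = 2 * hsdot (A *m y) v.
    have -> : S *m y = (2 : R)%:C *: (adjmx A *m v).
      by rewrite /y -(mulmxA F) (mulmxA S) SF -two -scalemxAl mul1mx.
    by rewrite hsdotC hsdotZl hsdotC hsdot_mull adjmxK.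
  rewrite hquad => h; have := hsdot_le x (A *m y) v; nra.
- move=> w w0 /=; rewrite -/X.
  have Fh : adjmx F = F.
    have FS' : adjmx F *m S = 2%:M.
      by rewrite -{1}Sh -adjmx_mul SF -two adjmxZ adjmx1.
    apply: (@scalerI _ _ (2 : C)); first by rewrite pnatr_eq0.
    by rewrite -mul_mx_scalar -SF mulmxA FS' mul_scalar_mx.
  pose Y := F *m (X - 1%:M).
  have Yh : adjmx Y = (X - 1%:M) *m F by rewrite adjmx_mul Fh adjmxB Xh adjmx1.
  have key : adjmx Y *m (S *m X) *m Y =
      (4 : R)%:C *: (X *m X) + (- 12 : R)%:C *: X + (8 : R)%:C *: (2%:M - F).
    by rewrite Yh; exact: resolvent_sandwich.
  (* Both summands are nonnegative multiples of Gram matrices, so sandwiching by [Y] keeps the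
     weighted trace nonnegative. *)
  have SX : S *m X = X + adjmx X *m X by rewrite Xh mulmxDl mul1mx.
  have : 0 <= trdg w (adjmx Y *m (S *m X) *m Y).
    have gr (Z : 'M[C]_n) : 0 <= trdg w (adjmx Y *m (adjmx Z *m Z) *m Y).
      have -> : adjmx Y *m (adjmx Z *m Z) *m Y = adjmx (Z *m Y) *m (Z *m Y).
        by rewrite adjmx_mul !mulmxA.
      exact: trdg_gram_ge0.
    rewrite SX mulmxDr mulmxDl trdgD addr_ge0//.
    by rewrite {1}/X -scalemxAr -scalemxAl trdgZ mulr_ge0.
  by rewrite key !trdgD !trdgZ; lra.
Qed.

End Achievability.

(** * One-shot achievability by random binning *)

Section RandomBinning.
Variable R : realType.
Local Notation C := (R[i]).
Implicit Types m n : nat.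

(** Two distinct points collide with probability 1/M. Shifting f(a) cyclically by c permutes the
    functions, and for each f exactly one c, namely f(b) - f(a), produces a collision. *)
Lemma sum_collision n m (a b : 'I_n) : a != b ->
  (\sum_(f : {ffun 'I_n -> 'I_m.+1}) (f a == f b)%:R) * m.+1%:R =
  #|{ffun 'I_n -> 'I_m.+1}|%:R :> R.
Proof.
move=> ab.
have shift (c : 'I_m.+1) : \sum_(f : {ffun 'I_n -> 'I_m.+1}) (f a == f b)%:R =
    \sum_(f : {ffun 'I_n -> 'I_m.+1}) (f a + c == f b)%:R :> R.
  pose h (c : 'I_m.+1) (f : {ffun 'I_n -> 'I_m.+1}) :=
    [ffun k => if k == a then f k + c else f k].
  rewrite (reindex (h c)) /=.
    by apply: eq_bigr => f _; rewrite !ffunE eqxx [b == a]eq_sym (negbTE ab).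
  exists (h (- c)) => f _; apply/ffunP => k; rewrite !ffunE; case: eqP => // _.
    by rewrite addrK.
  by rewrite subrK.
transitivity (\sum_(c : 'I_m.+1) \sum_(f : {ffun 'I_n -> 'I_m.+1}) (f a + c == f b)%:R : R).
  by rewrite -(eq_bigr _ (fun c _ => shift c)) sumr_const card_ord mulr_natr.
rewrite exchange_big -sum1_card natr_sum; apply: eq_bigr => f _.
rewrite (bigD1 (f b - f a)) //= subrKC eqxx big1 ?addr0// => c hc.
case: eqP => // e; move: hc; by rewrite -e addrAC subrr add0r eqxx.
Qed.

(** Off-diagonal pairs collide with probability 1/M, diagonal ones always; after scaling by M = m +
    1 the diagonal is counted m extra times. *)
Lemma sum_collision_diag n m (r : 'I_n -> 'I_n -> R) :
  m.+1%:R * (\sum_(f : {ffun 'I_n -> 'I_m.+1})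
     \sum_a \sum_b (f a == f b)%:R * r a b) =
  #|{ffun 'I_n -> 'I_m.+1}|%:R *
     (\sum_a \sum_b r a b + m%:R * \sum_a r a a).
Proof.
set T := #|_|%:R.
transitivity (\sum_a \sum_b (T * r a b + (if a == b then T * (m%:R * r a b) else 0))).
  rewrite exchange_big mulr_sumr; apply: eq_bigr => a _.
  rewrite exchange_big mulr_sumr; apply: eq_bigr => b _.
  rewrite -mulr_suml mulrA [_ * (\sum_f _)]mulrC; case: eqP => [->|/eqP ab].
    under eq_bigr do rewrite eqxx.
    by rewrite -natr_sum sum1_card -/T -natr1; ring.
  by rewrite sum_collision// addr0.
rewrite mulrDr !mulr_sumr -big_split; apply: eq_bigr => a _ /=.
rewrite big_split /= mulr_sumr; congr (_ + _).
rewrite (bigD1 a)//= eqxx big1 ?addr0// => b; rewrite eq_sym.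
by move=> /negbTE ->.
Qed.

Lemma exists_below_mean (I : finType) (f : I -> R) (c : R) : (0 < #|I|)%N ->
  \sum_i f i <= #|I|%:R * c -> exists i, f i <= c.
Proof.
move=> I0 hs; apply: contrapT => hn.
have : \sum_i f i > \sum_(i : I) c.
  have /card_gt0P [i0 _] := I0.
  rewrite [X in X < _](bigD1 i0)// [X in _ < X](bigD1 i0)//=; apply: ltr_leD.
    by rewrite ltNge; apply/negP => h; apply: hn; exists i0.
  apply: ler_sum => i _; rewrite leNgt; apply/negP => h; apply: hn; exists i.
  exact: ltW.
by rewrite sumr_const -mulr_natl ltNge hs.
Qed.

Lemma trdg_dg n (q q' : 'I_n -> R) (A B : 'M[C]_n) :
  complex.Re (\tr (dg q *m A *m (dg q' *m B))) =
  \sum_i \sum_k q i * q' k * complex.Re (A i k * B k i).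
Proof.
rewrite /mxtrace Re_sum; apply: eq_bigr => i _; rewrite mxE Re_sum.
apply: eq_bigr => k _; rewrite !mul_dg -!ReZ rmorphM; congr complex.Re; ring.
Qed.

Lemma weighted_gram n (U : 'M[C]_n) (w : 'I_n -> R) i :
  (U *m dg w *m adjmx U) i i = (weight U w i)%:C.
Proof.
rewrite mxE real_complex_sum; apply: eq_bigr => e _.
by rewrite mulmx_dg adjmxE [in RHS]rmorphM [X in _ = _ * X]normsqE; ring.
Qed.

(** This identity and the next two use cyclicity to move traces from the eigenbasis to the
    incoherent basis, where the bin projections are diagonal. *)
Lemma tr_sandwich n (W P Q U U' : 'M[C]_n) : W *m P = W -> P *m W = W ->
  \tr (W *m (P *m U' *m Q *m U *m P)) = \tr (Q *m (U *m W *m U')).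
Proof.
move=> WP PW; rewrite -!mulmxA (mulmxA W) WP mxtrace_mulC -!mulmxA PW.
by rewrite mxtrace_mulC !mulmxA.
Qed.

Lemma tr_sandwich2 n (W P Q U U' : 'M[C]_n) : W *m P = W -> P *m W = W ->
  P *m P = P ->
  \tr (W *m (P *m U' *m Q *m U *m P *m (P *m U' *m Q *m U *m P))) =
  \tr (Q *m (U *m P *m U') *m (Q *m (U *m W *m U'))).
Proof.
move=> WP PW PP; rewrite -!mulmxA (mulmxA W) WP (mulmxA P P) PP.
transitivity (\tr (U' *m (Q *m (U *m (P *m (U' *m (Q *m (U *m W)))))))).
  by rewrite [LHS]mxtrace_mulC -!mulmxA PW.
by rewrite [LHS]mxtrace_mulC -!mulmxA.
Qed.

Lemma tr_sandwich3 n (P Q U U' B B' : 'M[C]_n) : P *m P = P ->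
  \tr (Q *m (U *m P *m U') *m (Q *m (B *m B'))) =
  \tr (B' *m Q *m U *m P *m (P *m (U' *m (Q *m B)))).
Proof.
move=> PP; rewrite -!mulmxA (mulmxA P P) PP [RHS]mxtrace_mulC.
by rewrite -!mulmxA.
Qed.

Section Binning.
Variables (N m : nat) (U : 'M[C]_N) (l : 'I_N -> R) (E G : pred 'I_N) (s g : R).
Hypotheses (hU : Defs.unitarymx U) (l0 : forall e, 0 <= l e)
  (l1 : \sum_e l e = 1) (s0 : 0 <= s) (g0 : 0 <= g)
  (hE : forall e, E e -> 1 <= s * l e)
  (hG : forall i, G i -> weight U l i <= g).
Local Notation M := m.+1.
Let MR : 0 < M%:R :> R. Proof. by rewrite ltr0n. Qed.

(** The spectrum cut to [E], so that [a] is the mass that the truncated state keeps on [G]. The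
    bounds s and g stand for the inverse of the least typical eigenvalue and for the largest typical
    probability. *)
Let w e := l e * (E e)%:R.
Let P := dg (fun e => (E e)%:R : R).
Let a := \sum_(i | G i) weight U w i.
Let qf (f : {ffun 'I_N -> 'I_M}) (k : 'I_M) (i : 'I_N) : R := (G i && (f i == k))%:R.
Let Q f k := dg (qf f k).
Let A f k := Q f k *m U *m P.
Let X f k := M%:R%:C *: (adjmx (A f k) *m A f k).

Let w0 e : 0 <= w e.
Proof. by rewrite /w mulr_ge0. Qed.

Let wE e : w e * (E e)%:R = w e.
Proof. by rewrite /w; case: (E e); rewrite ?mulr1 ?mulr0. Qed.

Let PwP : dg w *m P = dg w.
Proof. by rewrite dgM; apply: eq_dg => e; rewrite wE. Qed.

Let Pw : P *m dg w = dg w.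
Proof. by rewrite dgM; apply: eq_dg => e; rewrite mulrC wE. Qed.

Let Qsum f i : \sum_k qf f k i = (G i)%:R.
Proof.
rewrite (bigD1 (f i))//= /qf eqxx andbT big1 ?addr0// => k.
by rewrite eq_sym => /negbTE ->; rewrite andbF.
Qed.

Let PP : P *m P = P.
Proof. by rewrite dgM; apply: eq_dg => e; case: (E e); rewrite ?mulr1 ?mulr0. Qed.

Let QQ f k : Q f k *m Q f k = Q f k.
Proof.
by rewrite dgM; apply: eq_dg => i; rewrite /qf; case: (_ && _); rewrite ?mulr1 ?mulr0.
Qed.

Let gramA f k : adjmx (A f k) *m A f k = P *m adjmx U *m Q f k *m U *m P.
Proof.
by rewrite /A !adjmx_mul !adj_dg !mulmxA -(mulmxA _ (Q f k) (Q f k)) QQ.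
Qed.

(** Exact for every f, not only on average, because the bins partition [G]. *)
Let first_moment f : \sum_k trdg w (X f k) = M%:R * a.
Proof.
transitivity (M%:R * \sum_k \sum_i qf f k i * weight U w i).
  rewrite mulr_sumr; apply: eq_bigr => k _; rewrite trdgZ; congr (_ * _).
  transitivity (complex.Re (\tr (Q f k *m (U *m dg w *m adjmx U)))).
    by rewrite /trdg gramA; apply: (congr1 (@complex.Re R)); exact: tr_sandwich.
  rewrite -/(trdg _ _) trdgE; apply: eq_bigr => i _.
  by rewrite weighted_gram.
congr (_ * _); rewrite exchange_big /a [in RHS]big_mkcond; apply: eq_bigr => i _.
rewrite -mulr_suml Qsum; case: (G i); rewrite ?mul1r ?mul0r //.
Qed.

(** The contribution of the pair (i, k) to the second moment, which counts only when i and k share a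
    bin. *)
Let r i k : R := (G i)%:R * (G k)%:R *
  complex.Re ((U *m P *m adjmx U) i k * (U *m dg w *m adjmx U) k i).

Let second_moment f :
  \sum_k trdg w (X f k *m X f k) =
  M%:R ^+ 2 * \sum_i \sum_k (f i == f k)%:R * r i k.
Proof.
transitivity (M%:R ^+ 2 * \sum_c \sum_i \sum_k qf f c i * qf f c k *
    complex.Re ((U *m P *m adjmx U) i k * (U *m dg w *m adjmx U) k i)).
  rewrite mulr_sumr; apply: eq_bigr => c _.
  rewrite /X -scalemxAl -scalemxAr !trdgZ mulrA -expr2; congr (_ * _).
  rewrite -trdg_dg /trdg gramA.
  apply: (congr1 (@complex.Re R)); exact: tr_sandwich2 PwP Pw PP.
congr (_ * _); rewrite exchange_big; apply: eq_bigr => i _.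
rewrite exchange_big; apply: eq_bigr => k _.
rewrite -mulr_suml /r !mulrA; congr (_ * _).
rewrite (bigD1 (f k))//= big1 => [|c hc]; last first.
  by rewrite /qf [f k == c]eq_sym (negbTE hc) andbF mulr0.
by rewrite addr0 /qf eqxx andbT; case: (G i); case: (G k); case: (f i == f k);
  rewrite ?(mulr1, mulr0, mul0r, addr0).
Qed.

(** The double sum is the squared norm of P U^+ Q_G B0; dropping the projection P and the unitary
    leaves that of Q_G B0, which is [a]. *)
Let sum_r_le : \sum_i \sum_k r i k <= a.
Proof.
pose Qg := dg (fun i => (G i)%:R : R).
pose B0 := U *m dg (fun e => Num.sqrt (w e)).
pose Z := P *m (adjmx U *m (Qg *m B0)).
have -> : \sum_i \sum_k r i k = hsnorm Z.
  rewrite -[LHS](trdg_dg (fun i => (G i)%:R) (fun i => (G i)%:R)) -/Qg.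
  rewrite [RHS]hsnorm_dot /hsdot; apply: (congr1 (@complex.Re R)).
  have -> : adjmx Z = adjmx B0 *m Qg *m U *m P.
    by rewrite (adjmx_mul P) (adjmx_mul (adjmx U)) (adjmx_mul Qg) adjmxK !adj_dg.
  have -> : U *m dg w *m adjmx U = B0 *m adjmx B0 by exact: spectral_sqrt.
  exact: tr_sandwich3 PP.
have P1 e : ((E e)%:R : R) ^+ 2 <= 1 by case: (E e); rewrite ?expr1n ?expr0n ?ler01.
apply: le_trans (hsnorm_dg_le _ P1) _; rewrite hsnorm_isometry ?adjmxK; last exact: hU.2.
rewrite hsnorm_dgl /a [X in _ <= X]big_mkcond; apply: ler_sum => i _.
case: (G i); rewrite ?expr1n ?expr0n ?mul0r// mul1r.
by apply: ler_sum => e _; rewrite mulmx_dg normsqM normsq_real sqr_sqrtr// mulrC.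
Qed.

Let weight_ge0 i : 0 <= weight U l i.
Proof. by apply: sumr_ge0 => e _; rewrite mulr_ge0 ?normsq_ge0. Qed.

Let sum_weight : \sum_i weight U l i = \sum_e l e.
Proof.
rewrite exchange_big; apply: eq_bigr => e _.
by rewrite -mulr_sumr unitary_col ?mulr1//; exact: hU.1.
Qed.

(** A diagonal term is the weight of [w] times the weight of the indicator of [E]. The latter is at
    most s times the weight of [l], since 1 <= s l_e on [E], hence at most s g on [G]. *)
Let sum_r_diag_le : \sum_i r i i <= s * g.
Proof.
apply: (@le_trans _ _ (\sum_i weight U l i * (s * g))); last first.
  by rewrite -mulr_suml sum_weight l1 mul1r.
apply: ler_sum => i _; rewrite /r !weighted_gram -rmorphM /=.
case: (boolP (G i)) => [Gi|_]; last by rewrite !mul0r !mulr_ge0.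
rewrite !mul1r mulr0 subr0 mulrC; apply: ler_pM.
- by apply: sumr_ge0 => e _; rewrite mulr_ge0 ?normsq_ge0.
- by apply: sumr_ge0 => e _; rewrite mulr_ge0 ?normsq_ge0.
- apply: ler_sum => e _; apply: ler_wpM2r; first exact: normsq_ge0.
  by rewrite /w; case: (E e); rewrite ?mulr1 ?mulr0.
apply: (@le_trans _ _ (s * weight U l i)); last by rewrite ler_wpM2l// hG.
rewrite /weight mulr_sumr; apply: ler_sum => e _; rewrite mulrA.
apply: ler_wpM2r; first exact: normsq_ge0.
by case: (boolP (E e)) => [/hE|_] //=; rewrite mulr_ge0.
Qed.

Let exists_binning : exists f,
  \sum_k trdg w (X f k *m X f k) <= M%:R * (a + M%:R * (s * g)).
Proof.
apply: exists_below_mean.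
  by apply/card_gt0P; exists [ffun=> ord0].
under eq_bigr do rewrite second_moment.
rewrite -mulr_sumr expr2 -mulrA sum_collision_diag mulrCA.
rewrite ler_wpM2l// ler_wpM2l// lerD//; apply: (@le_trans _ _ (m%:R * (s * g))).
  by rewrite ler_wpM2l.
by rewrite ler_wpM2r ?mulr_ge0// ler_nat.
Qed.

(** A union bound: the mass missing from [a] lies outside [G] or on eigenvectors outside [E]. *)
Let a_ge : 1 <= a + \sum_(i | ~~ G i) weight U l i + \sum_(e | ~~ E e) l e.
Proof.
have h i : weight U l i = weight U w i + \sum_(e | ~~ E e) l e * normsq (U i e).
  rewrite /weight [X in _ + X]big_mkcond -big_split; apply: eq_bigr => e _ /=.
  by rewrite /w; case: (E e) => /=; rewrite ?mulr1 ?mulr0 ?addr0 ?mul0r ?add0r.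
have h2 : \sum_(i | G i) \sum_(e | ~~ E e) l e * normsq (U i e) <= \sum_(e | ~~ E e) l e.
  rewrite exchange_big; apply: ler_sum => e _; rewrite -mulr_sumr.
  rewrite -[X in _ <= X]mulr1 ler_wpM2l// -(@unitary_col R N U e hU.1).
  rewrite big_mkcond; apply: ler_sum => i _; case: (G i) => //; exact: normsq_ge0.
have h3 : \sum_e l e = \sum_(i | G i) weight U l i + \sum_(i | ~~ G i) weight U l i.
  by rewrite -sum_weight (bigID G).
have h4 : \sum_(i | G i) weight U l i =
    a + \sum_(i | G i) \sum_(e | ~~ E e) l e * normsq (U i e).
  by rewrite /a -big_split; apply: eq_bigr => i _; rewrite h.
by rewrite -[X in X <= _]l1 h3 h4; move: h2; lra.
Qed.

Lemma achievability_oneshot : exists2 T : 'M[C]_N -> 'M[C]_M, incoherent_op T &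
  1 - 2 * (\sum_(i | ~~ G i) weight U l i + \sum_(e | ~~ E e) l e) - M%:R * (s * g) <=
  overlap (T (U *m dg l *m adjmx U)).
Proof.
have [f hf] := exists_binning.
have [F hF] := choice (fun k => resolventP (A f k) (ltW MR)).
pose V k := F k *m adjmx (A f k).
have VQ k : V k *m Q f k = V k.
  by rewrite /V /A !adjmx_mul !adj_dg -!mulmxA QQ.
(* The bin number k becomes the output index and the row c of V_k becomes the Kraus label. Since V_k
   is supported on the columns of bin k, column i of [K c] is nonzero at most in row f(i). *)
pose K c : 'M[C]_(M, N) := \matrix_(k, i) ((Num.sqrt M%:R)%:C * V k c i).
have [||T hT hov] := @kraus_completion R N M ord0 K.
- move=> c i; exists (f i) => k hk; rewrite mxE -VQ mulmx_dg /qf eq_sym (negbTE hk).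
  by rewrite andbF !mulr0.
- move=> v.
  have -> : \sum_c hsnorm (K c *m v) = \sum_k M%:R * hsnorm (V k *m v).
    rewrite /hsnorm exchange_big; apply: eq_bigr => k _; rewrite mulr_sumr.
    apply: eq_bigr => c _; rewrite mulr_sumr; apply: eq_bigr => j _.
    have -> : (K c *m v) k j = (Num.sqrt M%:R)%:C * (V k *m v) c j.
      by rewrite !mxE mulr_sumr; apply: eq_bigr => i _; rewrite mxE mulrA.
    by rewrite normsqM normsq_real sqr_sqrtr// ltW.
  apply: (@le_trans _ _ (\sum_k hsnorm (Q f k *m v))).
    apply: ler_sum => k _; rewrite -VQ -mulmxA.
    by have [_ h _] := hF k; exact: h.
  under eq_bigr do rewrite hsnorm_dgl.
  rewrite exchange_big; apply: ler_sum => i _; rewrite -mulr_suml.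
  rewrite -[X in _ <= X]mul1r ler_wpM2r//.
    by apply: sumr_ge0 => j _; exact: normsq_ge0.
  apply: (@le_trans _ _ (\sum_k qf f k i)); last by rewrite Qsum; case: (G i).
  apply: ler_sum => k _; rewrite /qf.
  by case: (_ && _); rewrite ?expr1n ?expr0n.
exists T => //; rewrite spectral_sqrt//; set B := U *m _.
apply: le_trans (hov B); pose W := \sum_k V k.
have -> : (\sum_c hsnorm (ones R M *m K c *m B)) / M%:R = hsnorm (W *m B).
  rewrite mulr_suml [in RHS]/hsnorm; apply: eq_bigr => c _.
  have -> : ones R M *m K c *m B = (Num.sqrt M%:R)%:C *: (row c W *m B).
    rewrite scalemxAl; congr (_ *m _); apply/rowP => i.
    rewrite !mxE summxE mulr_sumr; apply: eq_bigr => k _.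
    by rewrite !mxE mul1r.
  rewrite hsnormZ sqr_sqrtr ?ltW// mulrC mulrA mulVf ?gt_eqF// mul1r -row_mul.
  by rewrite /hsnorm big_ord1; apply: eq_bigr => j _; rewrite mxE.
(* The value that W B would take if every F_k were 1 and nothing were atypical. The squared norm of
   W B is at least 2 <D, W B> - |D|^2. *)
pose D := dg (fun e => Num.sqrt (w e)).
have frD : hsnorm D <= 1.
  rewrite -l1 -[D]mulmx1 hsnorm_dgl; apply: ler_sum => e _.
  rewrite sqr_sqrtr// (bigD1 e)//= big1 ?addr0 => [|k]; last first.
    by rewrite mxE eq_sym => /negbTE ->; rewrite normsq0.
  rewrite mxE eqxx normsq_real expr1n mulr1 /w.
  by case: (E e); rewrite ?mulr1 ?mulr0.
have VQU k : trdg w (V k *m U) = trdg w (F k *m (adjmx (A f k) *m A f k)).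
  have AQ : adjmx (A f k) *m Q f k = adjmx (A f k).
    by rewrite /A !adjmx_mul !adj_dg -!mulmxA QQ.
  have AA : adjmx (A f k) *m A f k = adjmx (A f k) *m U *m P.
    by rewrite {2}/A !mulmxA AQ.
  rewrite AA; apply: (congr1 (@complex.Re R)).
  by rewrite -[in LHS]Pw -mulmxA [LHS]mxtrace_mulC -!mulmxA.
have ipDW : M%:R * hsdot D (W *m B) = \sum_k trdg w (2%:M - F k).
  have -> : hsdot D (W *m B) = trdg w (W *m U).
    rewrite /hsdot adj_dg; apply: (congr1 (@complex.Re R)).
    rewrite [LHS]mxtrace_mulC /B -!mulmxA dgM [RHS]mxtrace_mulC -!mulmxA.
    congr (\tr (_ *m (_ *m _))); apply: eq_dg => e; rewrite /w.
    by case: (E e); rewrite ?mulr1 ?mulr0 ?sqrtr0 ?mulr0// -expr2 sqr_sqrtr.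
  rewrite mulmx_suml trdg_sum mulr_sumr; apply: eq_bigr => k _.
  have [<- _ _] := hF k.
  by rewrite VQU -trdgZ scalemxAr.
have h1 := hsdot_le 1 D (W *m B).
have h2 : 3 * \sum_k trdg w (X f k) - \sum_k trdg w (X f k *m X f k) <=
  2 * (M%:R * hsdot D (W *m B)).
  rewrite ipDW !mulr_sumr -sumrB; apply: ler_sum => k _.
  by have [_ _ h] := hF k; exact: h.
rewrite first_moment in h2.
(* The moments give 3 M a - M (a + M s g) = M (2 a - M s g). With |D|^2 <= 1 the overlap is at least
   2 a - 1 - M s g, and [a_ge] finishes. *)
have h3 : M%:R * (2 * a - M%:R * (s * g)) <= M%:R * (2 * hsdot D (W *m B)).
  move: h2 hf; lra.
rewrite ler_pM2l// in h3; move: h1 h3 frD a_ge; lra.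
Qed.

End Binning.
End RandomBinning.

(** * Tensor powers and typicality *)

Section TensorPowers.
Variable R : realType.
Local Notation C := (R[i]).
Implicit Types m n : nat.

Lemma sum_tens d D (F : 'I_(d * D) -> R) :
  \sum_x F x = \sum_i \sum_j F (mxtens_index (i, j)).
Proof.
rewrite pair_big (reindex (@mxtens_index d D)) /=; last first.
  by exists (@mxtens_unindex d D) => x _; rewrite ?mxtens_indexK ?mxtens_unindexK.
by apply: eq_bigr => -[].
Qed.

(** Product probability of a sequence, by the same recursion as [tpow], so that it is the diagonal
    of the tensor power of [dg f]. *)
Fixpoint iid d (f : 'I_d -> R) k : 'I_(dpow d k) -> R :=
  match k return 'I_(dpow d k) -> R with
  | 0 => fun=> 1
  | k'.+1 => fun x => f (mxtens_unindex x).1 * iid f (mxtens_unindex x).2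
  end.

Fixpoint isum d (h : 'I_d -> R) k : 'I_(dpow d k) -> R :=
  match k return 'I_(dpow d k) -> R with
  | 0 => fun=> 0
  | k'.+1 => fun x => h (mxtens_unindex x).1 + isum h (mxtens_unindex x).2
  end.

Lemma iid_tens d (f : 'I_d -> R) k i j :
  @iid d f k.+1 (mxtens_index (i, j)) = f i * iid f j.
Proof.
have -> x : @iid d f k.+1 x = f (mxtens_unindex x).1 * iid f (mxtens_unindex x).2 by [].
by rewrite mxtens_indexK.
Qed.

Lemma isum_tens d (h : 'I_d -> R) k i j :
  @isum d h k.+1 (mxtens_index (i, j)) = h i + isum h j.
Proof.
have -> x : @isum d h k.+1 x = h (mxtens_unindex x).1 + isum h (mxtens_unindex x).2 by [].
by rewrite mxtens_indexK.
Qed.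

Lemma tpowM d (A B : 'M[C]_d) k : tpow (A *m B) k = tpow A k *m tpow B k.
Proof. by elim: k => [|k IH] /=; rewrite ?mulmx1// IH tensmx_mul. Qed.

Lemma tpow_adj d (A : 'M[C]_d) k : tpow (adjmx A) k = adjmx (tpow A k).
Proof.
elim: k => [|k IH] /=; first by rewrite adjmx1.
by rewrite IH; apply/matrixP => x y; rewrite !mxE rmorphM.
Qed.

Lemma tpow_dg d (f : 'I_d -> R) k : tpow (dg f) k = dg (@iid d f k).
Proof.
elim: k => [|k IH]; first by apply: esym; exact: dg1.
rewrite [LHS](_ : _ = dg f *t tpow (dg f) k)// IH; apply/matrixP => x y.
case: (mxtens_indexP x) (mxtens_indexP y) => i j [i' j'].
rewrite tensmxE !dgE iid_tens (can_eq (@mxtens_indexK _ _)) xpair_eqE.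
by case: eqP => _; case: eqP => _ /=; rewrite ?mulr0n ?mul0r ?mulr0// rmorphM.
Qed.

Lemma tpow1 d k : tpow (1%:M : 'M[C]_d) k = 1%:M.
Proof.
rewrite -dg1 tpow_dg -dg1; apply: eq_dg => x.
elim: k x => // k IH x; case: (mxtens_indexP x) => i j.
by rewrite iid_tens IH mulr1.
Qed.

Lemma tpow_unitary d (U : 'M[C]_d) k : Defs.unitarymx U -> Defs.unitarymx (tpow U k).
Proof. by move=> [h1 h2]; split; rewrite -tpow_adj -tpowM ?h1 ?h2 tpow1. Qed.

Lemma tpow_spectral d (U : 'M[C]_d) (l : 'I_d -> R) k :
  tpow (U *m dg l *m adjmx U) k =
  tpow U k *m dg (@iid d l k) *m adjmx (tpow U k).
Proof. by rewrite !tpowM tpow_dg tpow_adj. Qed.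

(** Both sides are diagonal entries of the tensor power of U diag(l) U^+. *)
Lemma weight_tpow d (U : 'M[C]_d) (l : 'I_d -> R) k x :
  weight (tpow U k) (@iid d l k) x = @iid d (weight U l) k x.
Proof.
apply: (@complexI R); rewrite -weighted_gram -tpow_spectral.
elim: k x => [|k IH] x; first by rewrite (ord1 x) mxE eqxx.
case: (mxtens_indexP x) => i j.
by rewrite iid_tens real_complexM -IH -weighted_gram; exact: tensmxE.
Qed.

Lemma dpow_exp d k : dpow d k = (d ^ k)%N.
Proof. by elim: k => //= k ->; rewrite expnS. Qed.

Lemma tpow_Phi2 k : tpow (Phi2 R) k = const_mx ((dpow 2 k)%:R^-1).
Proof.
elim: k => [|k IH] /=.
  by apply/matrixP => i j; rewrite (ord1 i) (ord1 j) !mxE eqxx invr1.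
by rewrite IH; apply/matrixP => i j; rewrite !mxE natrM invfM div1r.
Qed.

Lemma incoherent_op_psd m n (T : 'M[C]_m -> 'M[C]_n) rho :
  incoherent_op T -> psdmx rho -> psdmx (T rho).
Proof.
move=> [L [K [_ _ ->]]] hr; apply: psd_sum => l.
by have := psd_congr (adjmx (K l)) hr; rewrite adjmxK.
Qed.

(** * Moments of i.i.d. sums and Chebyshev's inequality *)

Section Moments.
Variables (d : nat) (f : 'I_d -> R).
Hypotheses (f0 : forall i, 0 <= f i) (f1 : \sum_i f i = 1).

Lemma iid_ge0 k x : 0 <= @iid d f k x.
Proof.
elim: k x => [|k IH] x; first exact: ler01.
by case: (mxtens_indexP x) => i j; rewrite iid_tens mulr_ge0.
Qed.

Lemma iid_sum k : \sum_x @iid d f k x = 1.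
Proof.
elim: k => [|k IH]; first by rewrite big_ord1.
rewrite sum_tens; transitivity (\sum_i f i * \sum_j @iid d f k j).
  by apply: eq_bigr => i _; rewrite mulr_sumr; apply: eq_bigr => j _; rewrite iid_tens.
by rewrite IH -mulr_suml f1 mulr1.
Qed.

Variables (h : 'I_d -> R).
Hypothesis h0 : \sum_i f i * h i = 0.

Lemma iid_mean k : \sum_x @iid d f k x * @isum d h k x = 0.
Proof.
elim: k => [|k IH]; first by rewrite big_ord1 mulr0.
rewrite sum_tens; transitivity (\sum_i (f i * h i * \sum_j @iid d f k j +
   f i * \sum_j @iid d f k j * @isum d h k j)).
  apply: eq_bigr => i _; rewrite !mulr_sumr -big_split; apply: eq_bigr => j _.
  by rewrite iid_tens isum_tens /=; ring.
by rewrite big_split /= IH iid_sum -!mulr_suml h0 mul0r mulr0 addr0.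
Qed.

Lemma iid_variance k : \sum_x @iid d f k x * @isum d h k x ^+ 2 =
  k%:R * \sum_i f i * h i ^+ 2.
Proof.
elim: k => [|k IH]; first by rewrite big_ord1 expr0n mulr0 mul0r.
rewrite sum_tens; transitivity (\sum_i (f i * h i ^+ 2 * \sum_j @iid d f k j +
   (f i * h i * (2 * \sum_j @iid d f k j * @isum d h k j) +
   f i * \sum_j @iid d f k j * @isum d h k j ^+ 2))).
  apply: eq_bigr => i _; rewrite !mulr_sumr -!big_split; apply: eq_bigr => j _.
  by rewrite iid_tens isum_tens /=; ring.
rewrite !big_split /= IH iid_sum iid_mean -!mulr_suml h0 f1 -natr1; ring.
Qed.

Lemma iid_chebyshev k t : 0 < t ->
  t ^+ 2 * \sum_(x | `|@isum d h k x| > t) @iid d f k x <=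
  k%:R * \sum_i f i * h i ^+ 2.
Proof.
move=> t0; rewrite -iid_variance mulr_sumr big_mkcond; apply: ler_sum => x _.
case: ifP => [ht|_]; last by rewrite mulr_ge0 ?iid_ge0// sqr_ge0.
rewrite mulrC ler_wpM2l ?iid_ge0// -(real_normK (num_real (isum _ _))).
by rewrite ler_sqr ?nnegrE// ltW.
Qed.

End Moments.

(** * Base-2 exponentials and typical sets *)

Definition exp2 (x : R) : R := expR (x * ln 2).

Lemma exp2D x y : exp2 (x + y) = exp2 x * exp2 y.
Proof. by rewrite /exp2 mulrDl expRD. Qed.

Lemma exp2_gt0 x : 0 < exp2 x.
Proof. exact: expR_gt0. Qed.

Lemma exp2_le x y : x <= y -> exp2 x <= exp2 y.
Proof. by move=> h; rewrite /exp2 ler_expR ler_wpM2r// ltW// ln2_gt0. Qed.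

Lemma exp2_log2 x : 0 < x -> exp2 (log2 x) = x.
Proof. by move=> h; rewrite /exp2 /log2 h mulfVK ?gt_eqF ?ln2_gt0// lnK. Qed.

Lemma exp2_nat k : exp2 k%:R = (dpow 2 k)%:R.
Proof.
rewrite dpow_exp natrX /exp2 mulrC expRM_natr lnK// posrE ltr0n //.
Qed.

(** From x <= exp x. A rate 1/k suffices, as Chebyshev gives no better; all errors are therefore
    stated as k times the error being bounded. *)
Lemma exp2_decay k (b : R) : 0 < b -> k%:R * exp2 (- (k%:R * b)) <= (b * ln 2)^-1.
Proof.
move=> b0; have bl : 0 < b * ln 2 by rewrite mulr_gt0// ln2_gt0.
rewrite -[X in _ <= X]mul1r ler_pdivlMr// /exp2 mulNr expRN mulrAC.
rewrite ler_pdivrMr ?expR_gt0// mul1r mulrA.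
apply: le_trans (expR_ge1Dx _); lra.
Qed.

(** Chebyshev for the centred variable log f + H(f) with threshold k delta bounds the atypical mass
    by V / (k delta^2), V being its variance. *)
Lemma typical_set d (f : 'I_d -> R) (delta : R) :
  (forall i, 0 <= f i) -> \sum_i f i = 1 -> 0 < delta ->
  exists2 v : R, 0 <= v & forall k, exists E : pred 'I_(dpow d k),
    k%:R * (\sum_(x | ~~ E x) @iid d f k x) <= v /\
    forall x, E x ->
      exp2 (- (k%:R * (entropy f + delta))) <= @iid d f k x <=
      exp2 (- (k%:R * (entropy f - delta))).
Proof.
move=> f0 f1 d0; pose h i := log2 (f i) + entropy f.
have h0 : \sum_i f i * h i = 0.
  under eq_bigr do rewrite mulrDr.
  by rewrite big_split -mulr_suml f1 mul1r /entropy /= subrr.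
pose V := \sum_i f i * h i ^+ 2.
have V0 : 0 <= V by apply: sumr_ge0 => i _; rewrite mulr_ge0 ?sqr_ge0.
exists (V / delta ^+ 2); first by rewrite divr_ge0// sqr_ge0.
(* Positivity is demanded separately because [log2] is 0 at 0, so [isum] says nothing about
   sequences of probability zero; these carry no mass. *)
move=> k; exists (fun x => (0 < @iid d f k x) && (`|@isum d h k x| <= k%:R * delta)).
split.
  case: k => [|k]; first by rewrite mul0r divr_ge0// sqr_ge0.
  have kd : 0 < k.+1%:R * delta by rewrite mulr_gt0// ltr0n.
  rewrite ler_pdivlMr ?exprn_gt0// -(@ler_pM2l _ k.+1%:R) ?ltr0n//.
  apply: le_trans (iid_chebyshev f0 f1 h0 k.+1 kd).
  rewrite le_eqVlt; apply/orP; left; apply/eqP.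
  set S1 := \sum_(x | _) _; set S2 := \sum_(x | _) _.
  suff -> : S1 = S2 by ring.
  rewrite /S1 /S2 big_mkcond [RHS]big_mkcond; apply: eq_bigr => x _.
  case: (ltP 0 (iid f x)) => [_|fx]; first by rewrite /= -ltNge.
  have -> : iid f x = 0 by apply/eqP; rewrite eq_le fx iid_ge0.
  by rewrite !if_same.
move=> x /andP[px sx].
have -> : @iid d f k x = exp2 (@isum d h k x - k%:R * entropy f).
  move: px; clear sx; elim: k x => [|k IH] x.
    by rewrite /exp2 mul0r subr0 mul0r expR0.
  case: (mxtens_indexP x) => i j; rewrite iid_tens isum_tens => pos.
  have fp : 0 < f i.
    by rewrite lt_neqAle f0 andbT eq_sym; apply: contraTneq pos => ->; rewrite mul0r ltxx.
  have gp : 0 < @iid d f k j by rewrite pmulr_rgt0 in pos.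
  rewrite IH// -{1}(exp2_log2 fp) -exp2D; congr exp2.
  by rewrite /h -natr1; ring.
by move: sx; rewrite ler_norml => /andP[s1 s2]; apply/andP; split; apply: exp2_le; lra.
Qed.

End TensorPowers.

(** * Asymptotic rates *)

Section Asymptotics.
Variable R : realType.
Local Notation C := (R[i]).
Implicit Types m n : nat.

Variables (d : nat) (U : 'M[C]_d) (l : 'I_d -> R).
Hypotheses (hU : Defs.unitarymx U) (l0 : forall e, 0 <= l e)
  (l1 : \sum_e l e = 1).
Let rho := U *m dg l *m adjmx U.
Let p := weight U l.
Let rate := entropy p - entropy l.

Let p0 i : 0 <= p i.
Proof. by apply: sumr_ge0 => e _; rewrite mulr_ge0 ?normsq_ge0. Qed.

Let p1 : \sum_i p i = 1.
Proof.
rewrite exchange_big -[RHS]l1; apply: eq_bigr => e _.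
by rewrite -mulr_sumr unitary_col ?mulr1//; exact: hU.1.
Qed.

Let rho_psd k : psdmx (tpow rho k).
Proof.
rewrite tpow_spectral spectral_sqrt; last by move=> x; exact: iid_ge0.
by rewrite -[X in X *m _]adjmxK; exact: psd_gram.
Qed.

Let dpow2_gt0 t : (0 < dpow 2 t)%N.
Proof. by rewrite dpow_exp expn_gt0. Qed.

Let fidelity_Phi2 k t (T : 'M[C]_(dpow d k) -> 'M[C]_(dpow 2 t)) :
  incoherent_op T ->
  fidelity (T (tpow rho k)) (tpow (Phi2 R) t) = Num.sqrt (overlap (T (tpow rho k))).
Proof.
move=> hT; rewrite tpow_Phi2 fidelity_max_coherent//.
exact: incoherent_op_psd.
Qed.

(** With b a quarter of the gap, the exponent (H(p) + b) - (H(l) - b) - r equals -2b. *)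
Lemma converse_bound r : rate < r -> exists c : R,
  forall k (T : 'M[C]_(dpow d k) -> 'M[C]_(dpow 2 (Num.truncn (k%:R * r)))),
    incoherent_op T -> k%:R * overlap (T (tpow rho k)) <= c.
Proof.
move=> hr; pose b := (r - rate) / 4.
have b0 : 0 < b by rewrite divr_gt0// subr_gt0.
have [v1 v10 h1] := typical_set p0 p1 b0.
have [v2 v20 h2] := typical_set l0 l1 b0.
exists (2 * (v1 + v2) + 4 * (2 * b * ln 2)^-1) => k T hT.
have [G [hG Gb]] := h1 k; have [E [hE Eb]] := h2 k.
(* Each typical sequence has probability at least 2^(-k(H(p) + b)), and the total is 1. *)
have card_le : #|G|%:R <= exp2 (k%:R * (entropy p + b)).
  rewrite -(@ler_pM2r _ (exp2 (- (k%:R * (entropy p + b))))) ?exp2_gt0//.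
  rewrite -exp2D subrr {2}/exp2 mul0r expR0 -[X in _ <= X](iid_sum p1 k).
  rewrite [X in X <= _]mulr_natl -sumr_const [X in X <= _]big_mkcond; apply: ler_sum => x _.
  case: (boolP (x \in G)) => [Gx|_]; last exact: iid_ge0.
  by have /andP[] := Gb x Gx.
have mul := @converse_oneshot R _ _ (tpow U k) (@iid R d l k) T E G
  (exp2 (- (k%:R * (entropy l - b)))) (dpow2_gt0 _) (tpow_unitary k hU)
  (iid_ge0 l0 (k:=k)) hT (ltW (exp2_gt0 _)) (fun e he => (andP (Eb e he)).2).
rewrite -tpow_spectral in mul.
apply: le_trans (ler_wpM2l (ler0n _ k) mul) _.
have -> : \sum_(i | ~~ G i) weight (tpow U k) (@iid R d l k) i =
    \sum_(i | ~~ G i) @iid R d p k i.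
  by apply: eq_bigr => i _; rewrite weight_tpow.
set X := \sum_(i | _) _ in hG *; set Y := \sum_(i | _) _ in hE *.
set t := Num.truncn _.
have M0 : 0 < (dpow 2 t)%:R :> R by rewrite ltr0n.
have tail : exp2 (- (k%:R * (entropy l - b))) * #|G|%:R / (dpow 2 t)%:R <=
    2 * exp2 (- (k%:R * (2 * b))).
  rewrite ler_pdivrMr// -exp2_nat.
  apply: (@le_trans _ _ (exp2 (- (k%:R * (entropy l - b))) *
     exp2 (k%:R * (entropy p + b)))).
    by rewrite ler_wpM2l// ltW// exp2_gt0.
  (* The factor 2 absorbs the truncation, as t > k r - 1. *)
  have e2 : 2 = exp2 (1 : R) :> R by rewrite /exp2 mul1r lnK// posrE.
  rewrite [X in X * _ * _]e2 -!exp2D; apply: exp2_le.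
  have ht : k%:R * r < t%:R + 1.
    by rewrite natr1; exact: truncnS_gt.
  have : k%:R * r = k%:R * (entropy p - entropy l) + k%:R * (4 * b).
    by rewrite /b -/rate -mulrDr; congr (_ * _); field.
  lra.
have := exp2_decay k (mulr_gt0 (ltr0n _ 2 : 0 < 2%:R :> R) b0).
have : k%:R * (exp2 (- (k%:R * (entropy l - b))) * #|G|%:R / (dpow 2 t)%:R) <=
  k%:R * (2 * exp2 (- (k%:R * (2 * b)))) by rewrite ler_wpM2l.
lra.
Qed.

Lemma achievable_rate_le r : achievable_rate rho r -> r <= rate.
Proof.
move=> [r0 [T [hT [eps [heps hF]]]]]; rewrite leNgt; apply/negP => hr.
have [c hc] := converse_bound hr.
have [N _ hN] : \forall k \near \oo, eps k < 1 / 2.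
  have /cvgrPdist_lt /(_ (1 / 2)) := heps.
  rewrite divr_gt0// => /(_ isT); apply: filterS => k.
  by rewrite sub0r normrN; apply: le_lt_trans; exact: ler_norm.
pose k := maxn N (Num.truncn (4 * c)).+1.
have := hF k; rewrite fidelity_Phi2// => hk.
have := hN k (leq_maxl _ _) => ek.
(* Fidelity at least 1/2 means overlap at least 1/4, whereas k times the overlap is at most c and k
   > 4 c. *)
have ov : 1 / 4 <= overlap (T k (tpow rho k)).
  have s12 : 1 / 2 <= Num.sqrt (overlap (T k (tpow rho k))) by lra.
  have ov0 : 0 <= overlap (T k (tpow rho k)).
    rewrite leNgt; apply/negP => h; move: s12; rewrite ltr0_sqrtr//; lra.
  rewrite -(sqr_sqrtr ov0); nra.
have hk2 : 4 * c < k%:R.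
  apply: lt_le_trans (truncnS_gt _) _; rewrite ler_nat; exact: leq_maxr.
have := hc k (T k) (hT k).
have : k%:R * (1 / 4) <= k%:R * overlap (T k (tpow rho k)) by rewrite ler_wpM2l.
lra.
Qed.

(** Here s = 2^(k(H(l) + b)) and g = 2^(-k(H(p) - b)), so M s g <= 2^(-2kb) because the truncated
    exponent is at most k r. *)
Lemma achievability_bound r : 0 < r -> r < rate -> exists2 c : R, 0 <= c &
  forall k, exists2 T : 'M[C]_(dpow d k) -> 'M[C]_(dpow 2 (Num.truncn (k%:R * r))),
    incoherent_op T & k%:R * (1 - overlap (T (tpow rho k))) <= c.
Proof.
move=> r0 hr; pose b := (rate - r) / 4.
have b0 : 0 < b by rewrite divr_gt0// subr_gt0.
have bl : 0 < 2 * b * ln 2 by rewrite mulr_gt0 ?ln2_gt0// mulr_gt0.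
have [v1 v10 h1] := typical_set p0 p1 b0.
have [v2 v20 h2] := typical_set l0 l1 b0.
exists (2 * (v1 + v2) + (2 * b * ln 2)^-1).
  by rewrite addr_ge0 ?mulr_ge0 ?addr_ge0// invr_ge0 ltW.
move=> k; have [G [hG Gb]] := h1 k; have [E [hE Eb]] := h2 k.
set t := Num.truncn _.
have M0 : 0 < (dpow 2 t)%:R :> R by rewrite ltr0n.
have hEs e : E e -> 1 <= exp2 (k%:R * (entropy l + b)) * @iid R d l k e.
  move=> /Eb/andP[h _].
  rewrite -(ler_pM2l (exp2_gt0 (k%:R * (entropy l + b)))) in h.
  by apply: le_trans h; rewrite -exp2D subrr /exp2 mul0r expR0.
have hGs i : G i -> weight (tpow U k) (@iid R d l k) i <=
    exp2 (- (k%:R * (entropy p - b))).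
  by move=> /Gb/andP[_]; rewrite weight_tpow.
have [T hT hov] : exists2 T : 'M[C]_(dpow d k) -> 'M[C]_(dpow 2 t), incoherent_op T &
  1 - 2 * (\sum_(i | ~~ G i) weight (tpow U k) (@iid R d l k) i +
     \sum_(e | ~~ E e) @iid R d l k e) -
  (dpow 2 t)%:R * (exp2 (k%:R * (entropy l + b)) * exp2 (- (k%:R * (entropy p - b)))) <=
  overlap (T (tpow rho k)).
  rewrite tpow_spectral; case: (dpow 2 t) (dpow2_gt0 t) => // m _.
  exact: (achievability_oneshot m (tpow_unitary k hU) (iid_ge0 l0 (k:=k))
    (iid_sum l1 k) (ltW (exp2_gt0 _)) (ltW (exp2_gt0 _)) hEs hGs).
exists T => //; move: hov.
have -> : \sum_(i | ~~ G i) weight (tpow U k) (@iid R d l k) i =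
    \sum_(i | ~~ G i) @iid R d p k i.
  by apply: eq_bigr => i _; rewrite weight_tpow.
set X := \sum_(i | _) _ in hG *; set Y := \sum_(i | _) _ in hE *.
set Z := _ * (_ * _) => hov.
have tail : Z <= exp2 (- (k%:R * (2 * b))).
  rewrite /Z -exp2_nat -!exp2D; apply: exp2_le.
  have ht : t%:R <= k%:R * r by rewrite truncn_le mulr_ge0// ltW.
  have : k%:R * r = k%:R * (entropy p - entropy l) - k%:R * (4 * b).
    by rewrite /b -/rate -mulrBr; congr (_ * _); field.
  lra.
have := exp2_decay k (mulr_gt0 (ltr0n _ 2 : 0 < 2%:R :> R) b0).
have : k%:R * (1 - 2 * (X + Y) - exp2 (- (k%:R * (2 * b)))) <=
    k%:R * overlap (T (tpow rho k)).
  by rewrite ler_wpM2l//; apply: le_trans hov; rewrite lerB.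
lra.
Qed.

(** Turns a lower bound on the overlap into the same bound on the fidelity, since y^2 <= y for 0 < y
    <= 1. *)
Lemma le_sqrt (x y : R) : y <= 1 -> y <= x -> y <= Num.sqrt x.
Proof.
move=> y1 yx; have [y0|y0] := leP y 0; first exact: le_trans y0 (sqrtr_ge0 _).
have s0 := sqrtr_ge0 x; have sx := sqr_sqrtr (le_trans (ltW y0) yx).
rewrite leNgt; apply/negP => h; nra.
Qed.

Lemma achievable_rate_lt r : 0 < r -> r < rate -> achievable_rate rho r.
Proof.
move=> r0 hr; split; first exact: ltW.
have [c c0 hc] := achievability_bound r0 hr.
exists (fun k => projT1 (cid2 (hc k))); split.
  by move=> k; case: (cid2 _).
(* For k >= 1, c / k <= 2 c / (k + 1); the extra 1 makes the bound trivial at k = 0, where the error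
   term is at least 1. *)
exists (fun k => (2 * c + 1) * harmonic k); split.
  by rewrite -[X in _ --> X](mulr0 (2 * c + 1)); apply: cvgMr; exact: cvg_harmonic.
move=> k; case: (cid2 _) => T hT hov /=; rewrite fidelity_Phi2//.
case: k T hT hov => [|k] T hT hov.
  by apply: le_trans (sqrtr_ge0 _); rewrite /harmonic /= invr1; lra.
have k1 : 0 < k.+2%:R :> R by rewrite ltr0n.
apply: le_sqrt; first by rewrite gerBl mulr_ge0 ?invr_ge0 ?ltW//; lra.
rewrite /harmonic /= lerBlDr -lerBlDl ler_pdivlMr//.
move: hov; rewrite -[k.+2%:R]natr1; set o := overlap _; set q := k.+1%:R.
have q1 : 1 <= q by rewrite ler1n.
nra.
Qed.

(** The target has dimension 1, so any incoherent operation reaches it exactly; completing the zero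
    family supplies one. This also yields the nonnegativity of [rate]. *)
Lemma achievable_rate0 : achievable_rate rho 0.
Proof.
split=> //.
have trivial_op n (t : R) : t = 0 -> exists2 T : 'M[C]_n -> 'M[C]_(dpow 2 (Num.truncn t)),
    incoherent_op T & forall X, \tr (T X) = \tr X.
  move=> t0; have [||T hT _] := @kraus_completion R n (dpow 2 (Num.truncn t))
      (Ordinal (dpow2_gt0 _)) (fun=> 0).
  - by move=> _ i; exists (Ordinal (dpow2_gt0 _)) => j _; rewrite mxE.
  - move=> v; rewrite big1 ?hsnorm_ge0// => k _; rewrite mul0mx.
    by rewrite /hsnorm big1// => i _; rewrite big1// => j _; rewrite mxE normsq0.
  exists T => // X; have [L [K [_ hK ->]]] := hT.
  rewrite -[in RHS](mul1mx X) -hK mulmx_suml !tr_sum; apply: eq_bigr => k _.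
  by rewrite mxtrace_mulC mulmxA.
exists (fun k => projT1 (cid2 (trivial_op (dpow d k) (k%:R * 0) (mulr0 _)))).
split; first by move=> k; case: (cid2 _).
exists (fun=> 0); split; first exact: cvg_cst.
move=> k; case: (cid2 _) => T hT htr /=; rewrite fidelity_Phi2// subr0.
have -> : overlap (T (tpow rho k)) = 1; last by rewrite sqrtr1.
have ov1 m (X : 'M[C]_m) : m = 1%N -> overlap X = complex.Re (\tr X).
  by move=> m1; subst m; rewrite /overlap /mxtrace !big_ord1 divr1.
rewrite ov1; last by rewrite mulr0 truncn0.
rewrite htr tpow_spectral mxtrace_mulC mulmxA (tpow_unitary k hU).1 mul1mx.
rewrite /mxtrace Re_sum -[RHS](iid_sum l1 k); apply: eq_bigr => x _.
by rewrite dgE eqxx.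
Qed.

Lemma distillable_coherence_rate : distillable_coherence rho = rate%:E.
Proof.
have rate0 : 0 <= rate by exact: achievable_rate_le achievable_rate0.
apply/eqP; rewrite eq_le; apply/andP; split.
  by apply: ge_ereal_sup => _ [r hr <-]; rewrite lee_fin; exact: achievable_rate_le.
apply/lee_addgt0Pr => e e0.
(* If [rate] is at most e, the rate 0 is close enough; otherwise [rate - e] lies strictly between 0
   and [rate]. *)
have [h|h] := leP rate e.
  apply: (@le_trans _ _ (0%:E + e%:E)%E); first by rewrite -EFinD lee_fin add0r.
  by rewrite leeD2r//; apply: ereal_sup_ubound; exists 0 => //; exact: achievable_rate0.
have -> : rate%:E = ((rate - e)%:E + e%:E)%E by rewrite -EFinD subrK.
rewrite leeD2r//; apply: ereal_sup_ubound; exists (rate - e) => //.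
by apply: achievable_rate_lt; lra.
Qed.

End Asymptotics.

End Coherence.

Theorem theorem3 (R : realType) (d : nat) (rho : 'M[R[i]]_d) :
  density rho ->
  distillable_coherence rho = rel_ent_coh rho /\
  exists sigma : 'M[R[i]]_d,
    incoherent_state sigma /\ relent rho sigma = rel_ent_coh rho.
Proof.
move=> hrho; have [U [l [hU l0 hf]]] := mfunP hrho.1.
have [-> hsigma] := rel_ent_cohE hrho hU hf.
split=> //; set f := fun e => l ord0 e in l0 *.
have f1 : \sum_e f e = 1.
  by apply: (@complexI R); rewrite -(spectral_trace hU); exact: hrho.2.
rewrite {1}(spectral_decompE hU) -/f (distillable_coherence_rate hU.1 l0 f1).
congr ((_ - _)%:E); congr (- _); apply: eq_bigr => i _.
by rewrite (spectral_diag_entry i hU).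
Qed.
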